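(* Let $1\leqslant k\leqslant n$ be integers, let $\lambda\vdash k$, and let $x_1\geqslant x_2\geqslant\cdots\geqslant x_{n-1}>0$ be real numbers. If $a>0$ is a real number with \[ a\geqslant \frac{\vartheta(\lambda)}{1-\vartheta(\lambda)}\sum_{i=1}^{n-k}x_i , \] where the sum is zero when $k=n$, then \[ \mathscr P^\lambda\bigl(x_1^{-1},\ldots,x_{n-1}^{-1},-a^{-1}\bigr)\succeq 0 . \] Moreover, for every $\lambda\vdash k$ with $k\geqslant 1$, the coefficient $\vartheta(\lambda)/(1-\vartheta(\lambda))$ is sharp uniformly in $n$ and the weights, already when $n=k+1$ and $x_1=\cdots=x_k$: for every real $c<\vartheta(\lambda)/(1-\vartheta(\lambda))$ there are $x>0$ and $a>0$ with $a\geqslant c\,x$ such that, for $n=k+1$ and $x_1=\cdots=x_k=x$, the element $\mathscr P^\lambda(x^{-1},\ldots,x^{-1},-a^{-1})\in\mathbb C[\mathfrak S_{k+1}]$ is not $\succeq 0$.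
   Context: Group algebra order: for a finite group $G$, let $*$ be the antilinear involution on $\mathbb C[G]$ with $g^*=g^{-1}$. For self-adjoint $A\in\mathbb C[G]$ (i.e. $A^*=A$), write $A\succeq 0$ if $\rho(A)$ is positive semidefinite in every (finite-dimensional) unitary representation $\rho$ of $G$. Partitions: $\lambda\vdash k$ means $\lambda$ is a partition of $k$; $S^\lambda$ is the (complex) Specht module, $\chi^\lambda$ its character, $f^\lambda=\dim S^\lambda$ (so $S^{(k)}$ is trivial and $S^{(1^k)}$ is sign). Write $\mu\gtrdot\lambda$ if $\mu$ is obtained from $\lambda$ by adding one box. For $\lambda\vdash k$ and $\mu\gtrdot\lambda$ put \[ p^\uparrow(\lambda,\mu)=\frac{f^\mu}{(k+1)f^\lambda},\] and for nonempty $\lambda$ put $\vartheta(\lambda)=\max_{\mu\gtrdot\lambda}p^\uparrow(\lambda,\mu)$; one has $0<\vartheta(\lambda)<1$. Universal Plücker coordinates: let $[n]=\{1,\ldots,n\}$ and for $X\subseteq[n]$ regard $\mathfrak S_X$ as the subgroup of $\mathfrak S_n$ fixing the complement of $X$. For $\mathbf u=(u_1,\ldots,u_n)\in\mathbb C^n$ and $\lambda\vdash k$ with $k\leqslant n$, \[ \mathscr P^\lambda(\mathbf u)=\sum_{\substack{X\subseteq[n]\\|X|=k}}\Bigl(\sum_{\sigma\in\mathfrak S_X}\chi^\lambda(\sigma)\sigma\Bigr)\prod_{a\in[n]\setminus X}u_a\in\mathbb C[\mathfrak S_n],\] and $\mathscr P^\lambda(\mathbf u)=0$ if $k>n$. 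*)

(* Defs.v *)
From mathcomp Require Import all_boot all_order all_fingroup all_algebra.
From mathcomp Require Import mxrepresentation complex reals.

Set Implicit Arguments.
Unset Strict Implicit.
Unset Printing Implicit Defensive.

Import Order.TTheory GRing.Theory Num.Theory.
Local Open Scope ring_scope.

Section GroupAlgebra.

Variables (R : realType) (gT : finGroupType).

(* An element of C[gT], given by its coefficients. *)
Definition group_alg := {ffun gT -> R[i]}.

Definition galg_star (A : group_alg) : group_alg :=
  [ffun g => Num.conj (A g^-1%g)].

Definition galg_selfadjoint (A : group_alg) : Prop := galg_star A = A.

Definition unitary_repr d (rho : mx_representation R[i] [set: gT] d) : Prop :=
  forall g : gT, rho g \is unitarymx.

Definition galg_op d (rho : mx_representation R[i] [set: gT] d)
    (A : group_alg) : 'M[R[i]]_d :=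
  \sum_(g : gT) A g *: rho g.

Definition conj_trmx m n (M : 'M[R[i]]_(m, n)) : 'M[R[i]]_(n, m) :=
  map_mx Num.conj M^T.

(* In the partial order of R[i], 0 <= z means that z is real and nonnegative. *)
Definition psd_mx d (M : 'M[R[i]]_d) : Prop :=
  conj_trmx M = M /\
  forall v : 'cV[R[i]]_d, 0 <= (conj_trmx v *m M *m v) 0 0.

Definition galg_psd (A : group_alg) : Prop :=
  forall d (rho : mx_representation R[i] [set: gT] d),
    unitary_repr rho -> psd_mx (galg_op rho A).

End GroupAlgebra.

(* Partitions are weakly decreasing lists of positive integers. *)
Definition is_part (la : seq nat) : bool := sorted geq la && (0%N \notin la).

Definition part_of (k : nat) (la : seq nat) : bool :=
  is_part la && (sumn la == k).

(* The partitions obtained from la by adding one box. *)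
Definition add_box (la : seq nat) : seq (seq nat) :=
  [seq mu <- [seq incr_nth la i | i <- iota 0 (size la).+1] | is_part mu].

Section Specht.

Variables (R : realType) (T : finType) (X : {set T}) (la : seq nat).

(* The tableau t of shape la whose entries are the elements of X, in the order *)
(* of enum X, written row after row; la is meant to be a partition of #|X|.    *)
Definition tab_row (x : T) : nat := reshape_index la (index x (enum X)).
Definition tab_col (x : T) : nat := reshape_offset la (index x (enum X)).

Definition row_stab : {set {perm T}} :=
  [set s in Sym X | [forall x in X, tab_row (s x) == tab_row x]].
Definition col_stab : {set {perm T}} :=
  [set s in Sym X | [forall x in X, tab_col (s x) == tab_col x]].

Definition specht_regular := regular_repr R[i] (Sym_group X).

(* The polytabloid e_t of C[Sym X]: row symmetrizer and signed column          *)
(* antisymmetrizer of t. Since (p * q)%g x = q (p x), it is, for the           *)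
(* composition of functions, (sum of sgn(q) q) o (sum of p).                   *)
Definition polytabloid : 'rV[R[i]]_(gcard (Sym_group X)) :=
  gring_row ((\sum_(p in row_stab) specht_regular p)
             *m (\sum_(q in col_stab) (-1) ^+ odd_perm q *: specht_regular q)).

(* S^la for the symmetric group of X: the submodule generated by e_t in the    *)
(* left ideal generated by the row symmetrizer, which is a copy of the         *)
(* permutation module on the tabloids of shape la.                             *)
Definition specht_mx := cyclic_mx specht_regular polytabloid.

Definition specht_repr :=
  submod_repr (cyclic_mx_module specht_regular polytabloid).

Definition specht_char (s : {perm T}) : R[i] := \tr (specht_repr s).

Definition specht_dim : nat := \rank specht_mx.

End Specht.

Section Growth.

Variable R : realType.

Definition part_dim (la : seq nat) : nat :=
  specht_dim R [set: 'I_(sumn la)] la.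

Definition p_up (la mu : seq nat) : R :=
  (part_dim mu)%:R / ((sumn la).+1%:R * (part_dim la)%:R).

(* All the p_up la mu are nonnegative and add_box la is nonempty for a         *)
(* partition la, so the initial value 0 does not change the maximum.           *)
Definition vartheta (la : seq nat) : R :=
  \big[Num.max/0]_(mu <- add_box la) p_up la mu.

End Growth.

(* Coefficient of s in P^la(u): the permutation s contributes to the summands  *)
(* of those X for which it lies in Sym X. No X has #|X| = |la| if |la| > n.    *)
Definition plucker (R : realType) (n : nat) (la : seq nat) (u : 'I_n -> R[i]) :
    group_alg R 'S_n :=
  [ffun s => \sum_(X : {set 'I_n} | (#|X| == sumn la) && (s \in Sym X))
               specht_char R X la s * \prod_(a in ~: X) u a].

(* The vector (x_1^-1, ..., x_(n-1)^-1, - a^-1), with x indexed from 1.        *)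
Definition weights (R : realType) (n : nat) (x : nat -> R) (a : R) :
    'I_n -> R[i] :=
  fun i => (if i.+1 == n then - a^-1 else (x i.+1)^-1)%:C%C.

(* Main.v *)
From HB Require Import structures.
Require Import Defs.
From mathcomp Require Import all_boot all_order all_fingroup all_algebra.
From mathcomp Require Import mxrepresentation complex reals zify ring lra.

(** For #|X| = k let alpha_X be the sum of chi^la(s) s over s in Sym X; in a unitary
    representation it acts as k! / f^la times an orthogonal projection.  The
    branching rule gives, for #|Z| = k + 1,
      sum_(j in Z) alpha_(Z - j)^la = sum_(mu covering la) alpha_Z^mu,
    and comparing the scalars k! / f^la and (k + 1)! / f^mu yields the local
    inequality alpha_(Z - z) <= vartheta(la) sum_(j in Z) alpha_(Z - j).  With z the
    index carrying the negative weight, adding up these inequalities over all Z,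
    weighted by products of the x_i^-1, gives positivity.  For n = k + 1 the local
    inequality is an equality on the image of the projections onto la and onto a
    mu attaining vartheta(la), which gives sharpness in the regular representation.

    With c = a b a Young symmetrizer and c c = h c, alpha is h^-1 times the sum of
    the conjugates of c, so orthogonality follows from c x c being proportional to
    c.  Completeness of the Specht modules and multiplicity one in the branching
    rule both follow from f^mu >= sum_(la below mu) f^la, sum f^2 <= k! and the
    identity sum (number of standard tableaux)^2 = k!. *)

Import Order.TTheory GRing.Theory Num.Theory.
Local Open Scope ring_scope.

Set Implicit Arguments.
Unset Strict Implicit.
Unset Printing Implicit Defensive.

(** * Rank and trace of quasi-idempotent matrices *)

(** The coefficient [theta / (1 - theta)] arises because the local inequality has [alpha_(Z - z)] on
    both sides. Solving for it bounds a set avoiding [z] by the sets obtained from it by exchanging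
    one element with [z]. Each set [Y] containing [z] is then charged with the [x_j] for [j] outside
    [Y]; there are [n - k] of these, whence the partial sum of the [x_i]. Branching multiplicities
    are never computed from irreducibility. They are traces of quasi-idempotent operators, hence
    ranks, hence natural numbers; lower bounds come from restricting one Young symmetrizer to a
    smaller set, and the count of standard tableaux leaves no room for anything larger. All the
    [alpha_X] are kept in a single group algebra, as elements supported on [Sym X], so that those of
    different [X] can be multiplied and compared. *)

Lemma mxtrace_quasi_idem (F : fieldType) n (M : 'M[F]_n) (h : F) :
  M *m M = h *: M -> \tr M = h * (\rank M)%:R.
Proof.
move=> MM; set C := col_base M; set B := row_base M.
have defM : C *m B = M by rewrite mulmx_base.
(* In a full-rank factorization the outer factors cancel from [C B C B = h C B]; the trace of [M] is
   then that of the scalar matrix [B C], of size [\rank M]. *)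
have BC : B *m C = h%:M.
  have CK : row_full C by rewrite col_base_full.
  have BK : row_free B by rewrite row_base_free.
  apply: (row_full_inj CK); apply: (row_free_inj BK).
  have: (C *m B) *m (C *m B) = h *: (C *m B) by rewrite defM.
  by rewrite mul_mx_scalar -scalemxAl !mulmxA.
by rewrite -{1}defM mxtrace_mulC BC mxtrace_scalar mulr_natr.
Qed.

(** In characteristic zero the trace determines the rank. *)
Lemma quasi_idem_eq0 (F : numFieldType) n (M : 'M[F]_n) (h : F) :
  M *m M = h *: M -> \tr M = 0 -> h != 0 -> M = 0.
Proof.
move=> /mxtrace_quasi_idem-> /eqP + /negPf h0; rewrite mulf_eq0 h0 pnatr_eq0.
by rewrite mxrank_eq0 => /eqP.
Qed.

(** * The group algebra *)

Section GroupAlgebraRing.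

Variables (F : fieldType) (gT : finGroupType).

(** [F^o] supplies the scalar action on functions, and the type stays convertible to [group_alg];
    the convolution product is added below. *)
Definition galg : Type := {ffun gT -> F^o}.

HB.instance Definition _ := GRing.Lmodule.on galg.

Implicit Types x y z : galg.

Definition galg_one : galg := [ffun g => (g == 1%g)%:R].
Definition galg_mul x y : galg := [ffun g => \sum_h x h * y (h^-1 * g)%g].

Fact galg_mulA : associative galg_mul.
Proof.
move=> x y z; apply/ffunP=> g; rewrite !ffunE.
under eq_bigr => h _ do rewrite ffunE big_distrr /=.
under [RHS]eq_bigr => h _ do rewrite ffunE big_distrl /=.
rewrite [RHS]exchange_big /=; apply: eq_bigr => h _.
rewrite [RHS](reindex_inj (mulgI h)%g) /=; apply: eq_bigr => k _.
by rewrite mulrA invMg !mulgA mulVg mul1g.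
Qed.

Fact galg_mul1 : left_id galg_one galg_mul.
Proof.
move=> x; apply/ffunP=> g; rewrite !ffunE (bigD1 1%g) //= !ffunE eqxx mul1r.
rewrite invg1 mul1g big1 ?addr0 // => h /negPf h1.
by rewrite ffunE h1 mul0r.
Qed.

Fact galg_mulr1 : right_id galg_one galg_mul.
Proof.
move=> x; apply/ffunP=> g; rewrite !ffunE (bigD1 g) //= !ffunE mulVg eqxx mulr1.
rewrite big1 ?addr0 // => h /negPf h1.
by rewrite ffunE -eq_invg_mul invgK h1 mulr0.
Qed.

Fact galg_mulDl : left_distributive galg_mul +%R.
Proof.
move=> x y z; apply/ffunP=> g; rewrite !ffunE -big_split /=.
by apply: eq_bigr => h _; rewrite ffunE mulrDl.
Qed.

Fact galg_mulDr : right_distributive galg_mul +%R.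
Proof.
move=> x y z; apply/ffunP=> g; rewrite !ffunE -big_split /=.
by apply: eq_bigr => h _; rewrite ffunE mulrDr.
Qed.

Fact galg_one_neq0 : galg_one != 0.
Proof. by apply/eqP => /ffunP/(_ 1%g)/eqP; rewrite !ffunE eqxx oner_eq0. Qed.

HB.instance Definition _ := GRing.Zmodule_isNzRing.Build galg
  galg_mulA galg_mul1 galg_mulr1 galg_mulDl galg_mulDr galg_one_neq0.

Fact galg_scaleAl (a : F) x y : a *: (x * y) = (a *: x) * y.
Proof.
apply/ffunP=> g; rewrite !ffunE /GRing.scale /= big_distrr /=.
by apply: eq_bigr => h _; rewrite ffunE mulrA.
Qed.

HB.instance Definition _ := GRing.Lmodule_isLalgebra.Build F galg galg_scaleAl.

Fact galg_scaleAr (a : F) x y : a *: (x * y) = x * (a *: y).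
Proof.
apply/ffunP=> g; rewrite !ffunE /GRing.scale /= big_distrr /=.
by apply: eq_bigr => h _; rewrite ffunE mulrCA.
Qed.

HB.instance Definition _ := GRing.Lalgebra_isAlgebra.Build F galg galg_scaleAr.

Definition gdelta (g : gT) : galg := [ffun h => (h == g)%:R].

Lemma galgME x y g : (x * y) g = \sum_h x h * y (h^-1 * g)%g.
Proof. by rewrite ffunE. Qed.

Lemma galgDE x y g : (x + y) g = x g + y g.
Proof. by rewrite ffunE. Qed.

Lemma galgZE a x g : (a *: x) g = a * x g.
Proof. by rewrite ffunE. Qed.

Lemma galg_sumE I (r : seq I) (P : pred I) (X : I -> galg) g :
  (\sum_(i <- r | P i) X i) g = \sum_(i <- r | P i) X i g.
Proof. exact: (@sum_ffunE _ F^o). Qed.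

Lemma gdeltaM : {morph gdelta : g h / (g * h)%g >-> g * h}.
Proof.
move=> g h; apply/ffunP=> k; rewrite galgME (bigD1 g) //= !ffunE eqxx mul1r.
rewrite big1 ?addr0 => [|i /negPf ig]; last by rewrite ffunE ig mul0r.
by rewrite -[in RHS](inj_eq (mulgI g)) mulKVg.
Qed.

Lemma gdelta1 : gdelta 1%g = 1.
Proof. by []. Qed.

Lemma gdelta_mulE g x h : (gdelta g * x) h = x (g^-1 * h)%g.
Proof.
rewrite galgME (bigD1 g) //= !ffunE eqxx mul1r.
by rewrite big1 ?addr0 // => i /negPf ig; rewrite ffunE ig mul0r.
Qed.

Lemma galg_mul_deltaE x g h : (x * gdelta g) h = x (h * g^-1)%g.
Proof.
rewrite galgME (bigD1 (h * g^-1)%g) //= ffunE invMg invgK mulgKV eqxx mulr1.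
rewrite big1 ?addr0 // => i ni; rewrite ffunE -(inj_eq (mulgI i)) mulKVg.
rewrite (_ : (h == i * g)%g = false) ?mulr0 //.
by apply: contraNF ni => /eqP->; rewrite mulgK.
Qed.

Lemma galg_expand x : x = \sum_g x g *: gdelta g.
Proof.
apply/ffunP=> h; rewrite galg_sumE (bigD1 h) //= galgZE ffunE eqxx mulr1.
rewrite big1 ?addr0 // => i ih.
by rewrite galgZE ffunE eq_sym (negPf ih) mulr0.
Qed.

Lemma galg_mul_expand x y :
  x * y = \sum_g \sum_h (x g * y h) *: gdelta (g * h)%g.
Proof.
rewrite {1}[x]galg_expand {1}[y]galg_expand mulr_suml; apply: eq_bigr => g _.
rewrite mulr_sumr; apply: eq_bigr => h _.
by rewrite -scalerAr -scalerAl scalerA mulrC gdeltaM.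
Qed.

(** The canonical trace of the group algebra: times the group order it is the trace of left
    multiplication by [x], so that dimensions can be read from one coefficient. *)
Definition gtau x : F := x 1%g.

Lemma gtauD x y : gtau (x + y) = gtau x + gtau y.
Proof. exact: galgDE. Qed.

Lemma gtauZ a x : gtau (a *: x) = a * gtau x.
Proof. exact: galgZE. Qed.

Lemma gtau_sum I (r : seq I) (P : pred I) (X : I -> galg) :
  gtau (\sum_(i <- r | P i) X i) = \sum_(i <- r | P i) gtau (X i).
Proof. exact: galg_sumE. Qed.

Lemma gtau_mulC x y : gtau (x * y) = gtau (y * x).
Proof.
rewrite /gtau !galgME (reindex_inj invg_inj) /=.
by apply: eq_bigr => h _; rewrite invgK !mulg1 mulrC.
Qed.

Lemma gtau_delta x g : gtau (x * gdelta g^-1) = x g.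
Proof. by rewrite /gtau galg_mul_deltaE invgK mul1g. Qed.

(** ** Elements supported on a subgroup *)

Variable H : {group gT}.

Definition gsupp : {pred galg} := fun x => [forall g, (g \notin H) ==> (x g == 0)].

Lemma gsuppP x : reflect (forall g, g \notin H -> x g = 0) (x \in gsupp).
Proof.
apply: (iffP forallP) => [xH g gH|xH g]; first exact/eqP/(implyP (xH g)).
by apply/implyP=> /xH->.
Qed.

Fact gsupp_subring : subring_closed gsupp.
Proof.
split=> [|x y /gsuppP xH /gsuppP yH|x y /gsuppP xH /gsuppP yH].
- apply/gsuppP=> g gH; rewrite ffunE; case: eqP gH => // ->.
  by rewrite group1.
- by apply/gsuppP=> g gH; rewrite !ffunE xH ?yH ?subr0.
apply/gsuppP=> g gH; rewrite galgME big1 // => h _.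
have [hH|/xH->] := boolP (h \in H); last by rewrite mul0r.
by rewrite yH ?mulr0 // groupMl ?groupV.
Qed.

HB.instance Definition _ := GRing.isSubringClosed.Build galg gsupp
  gsupp_subring.

Lemma gsuppZ a x : x \in gsupp -> a *: x \in gsupp.
Proof.
by move=> /gsuppP xH; apply/gsuppP=> g gH; rewrite galgZE xH ?mulr0.
Qed.

Lemma gsupp_delta g : g \in H -> gdelta g \in gsupp.
Proof.
by move=> gH; apply/gsuppP=> h hH; rewrite ffunE; case: eqP hH => // ->; rewrite gH.
Qed.

Lemma gsupp_expand x : x \in gsupp -> x = \sum_(g in H) x g *: gdelta g.
Proof.
move=> /gsuppP xH; rewrite [LHS]galg_expand [LHS](bigID (mem H)) /=.
by rewrite [X in _ + X]big1 ?addr0 // => g gH; rewrite xH ?scale0r.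
Qed.

Lemma gsupp_expand_mul x y z : x \in gsupp ->
  y * x * z = \sum_(g in H) x g *: (y * gdelta g * z).
Proof.
move=> xH; rewrite {1}(gsupp_expand xH) mulr_sumr mulr_suml.
by apply: eq_bigr => g _; rewrite -scalerAr -scalerAl.
Qed.

Lemma gsupp_comm x y : x \in gsupp ->
  (forall g, g \in H -> gdelta g * y = y * gdelta g) -> x * y = y * x.
Proof.
move=> xH yC; rewrite -[LHS]mul1r mulrA -[RHS]mulr1 !(gsupp_expand_mul _ _ xH).
by apply: eq_bigr => g gH; rewrite mul1r mulr1 yC.
Qed.

(** ** The operators x |-> u * x * v on F[H] *)

Definition gopmx (u v : galg) : 'M[F]_#|H| :=
  \matrix_(i, j) (u * gdelta (enum_val i) * v) (enum_val j).

(** Matrices act on row vectors from the right, so the left factors compose in reverse order. *)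
Lemma gopmxM u v u' v' : u \in gsupp -> v \in gsupp ->
  gopmx u v *m gopmx u' v' = gopmx (u' * u) (v * v').
Proof.
move=> uH vH; apply/matrixP=> i j; rewrite !mxE.
set w := u * gdelta (enum_val i) * v.
have wH : w \in gsupp by rewrite !rpredM ?gsupp_delta ?enum_valP.
transitivity ((u' * w * v') (enum_val j)); last by rewrite /w !mulrA.
rewrite (gsupp_expand wH) mulr_sumr mulr_suml galg_sumE /= [RHS]big_enum_val /=.
by apply: eq_bigr => k _; rewrite !mxE -scalerAr -scalerAl galgZE.
Qed.

Lemma gopmxZ a u v : gopmx (a *: u) v = a *: gopmx u v.
Proof. by apply/matrixP=> i j; rewrite !mxE -!scalerAl galgZE. Qed.

(** The source of [ychar]: taking a trace on [F[H]] replaces [u] by the sum of its conjugates. *)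
Lemma gopmx_tr u v : \tr (gopmx u v) =
  gtau ((\sum_(g in H) gdelta g^-1 * u * gdelta g) * v).
Proof.
rewrite mulr_suml gtau_sum big_enum_val /=; apply: eq_bigr => i _.
by rewrite !mxE -!mulrA gtau_mulC !mulrA gtau_delta.
Qed.

Lemma gopmx_eq0 u : u \in gsupp -> gopmx u 1 = 0 -> u = 0.
Proof.
move=> uH /matrixP M0; apply/ffunP=> g; rewrite [RHS]ffunE.
have [gH|] := boolP (g \in H); last by move/gsuppP: uH; apply.
have := M0 (enum_rank_in (group1 H) 1%g) (enum_rank_in (group1 H) g).
by rewrite !mxE !enum_rankK_in // mulr1 gdelta1 mulr1.
Qed.

End GroupAlgebraRing.

Arguments gdelta F {gT} g.

(** * Tableaux *)

Section Diagrams.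

Local Open Scope nat_scope.

Definition diag (la : seq nat) : seq (nat * nat) :=
  [seq (i, j) | i <- iota 0 (size la), j <- iota 0 (nth 0 la i)].

Lemma diag_uniq la : uniq (diag la).
Proof.
apply: allpairs_uniq_dep => [|i _|[i j] [i' j'] _ _ [-> ->]] //;
  exact: iota_uniq.
Qed.

Lemma mem_diag la p : (p \in diag la) = (p.2 < nth 0 la p.1).
Proof.
case: p => i j /=; apply/allpairsPdep/idP => [[i' [j' []]]|ji].
  by rewrite !mem_iota !add0n /= => ? ? [-> ->].
exists i, j; split=> //; rewrite mem_iota add0n //=.
by case: ltnP => // /(nth_default 0) i0; rewrite i0 in ji.
Qed.

Lemma size_diag la : size (diag la) = sumn la.
Proof.
rewrite size_allpairs_dep; congr sumn.
by under eq_map => i do rewrite size_iota; rewrite map_nth_iota0 // take_size.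
Qed.

Lemma count_diag_row la i : count (fun p => p.1 == i) (diag la) = nth 0 la i.
Proof.
rewrite count_flatten -map_comp.
rewrite (eq_map (g := fun k => if k == i then nth 0 la k else 0)); last first.
  move=> k /=; rewrite count_map; case: (k =P i) => [->|ki].
    by rewrite (eq_count (a2 := predT)) ?count_predT ?size_iota // => x /=; rewrite eqxx.
  by rewrite (eq_count (a2 := pred0)) ?count_pred0 // => x /=; apply/eqP.
rewrite sumnE big_map -big_mkcond /=.
have [ilt|ige] := ltnP i (size la); last first.
  rewrite nth_default // big_seq_cond big1 // => k; rewrite mem_iota add0n.
  by case/andP=> /= klt /eqP ki; move: klt; rewrite ki ltnNge ige.
rewrite -big_filter filter_pred1_uniq ?iota_uniq ?mem_iota ?add0n //.
by rewrite big_seq1.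
Qed.

(** The number of cells in the first [j] columns. Comparing these numbers for all [j] is the
    dominance order up to transposition. *)
Definition colsum la j := count (fun p => p.2 < j) (diag la).

Lemma colsumE la j : colsum la j = \sum_(v <- la) minn v j.
Proof.
rewrite /colsum count_flatten -map_comp.
rewrite (eq_map (g := fun k => minn (nth 0 la k) j)); last first.
  move=> k /=; rewrite count_map -size_filter /=.
  have [jle|/ltnW jge] := leqP j (nth 0 la k).
    by rewrite (filter_iota_ltn 0 jle) size_iota.
  rewrite (eq_in_filter (a2 := predT)) ?filter_predT ?size_iota // => i.
  by rewrite mem_iota /= => /leq_trans; apply.
by rewrite sumnE big_map [RHS](big_nth 0) /index_iota subn0.
Qed.

End Diagrams.

(** * Tableaux on a finite set, their stabilizers and collisions *)

Section Tableau.

Local Open Scope nat_scope.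

Variables (T : finType) (X : {set T}).
Implicit Types (t : T -> nat * nat) (r : T -> nat) (la mu : seq nat).

(** A tableau is stored as the map from entries to cells, the inverse of the usual filling:
    permutations act by precomposition, and values outside [X] do not matter. *)
Definition is_tab la t := perm_eq [seq t x | x <- enum X] (diag la).

Lemma tab_mem la t x : is_tab la t -> x \in X -> (t x).2 < nth 0 la (t x).1.
Proof.
move=> /perm_mem tD xX; rewrite -mem_diag -tD.
by apply: map_f; rewrite mem_enum.
Qed.

Lemma tab_inj la t : is_tab la t -> {in X &, injective t}.
Proof.
move=> tD; apply/dinjectiveP.
by rewrite /dinjectiveb (perm_uniq tD) diag_uniq.
Qed.

Lemma tab_count la t (P : pred (nat * nat)) : is_tab la t ->
  #|[set x in X | P (t x)]| = count P (diag la).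
Proof.
move=> tD; rewrite -(seq.permP tD) count_map -size_filter cardE.
apply/perm_size/uniq_perm => [||x].
- exact: enum_uniq.
- by rewrite filter_uniq ?enum_uniq.
by rewrite mem_enum inE [RHS]mem_filter mem_enum andbC.
Qed.

Lemma tab_card la t : is_tab la t -> #|X| = sumn la.
Proof.
by move=> tD; rewrite -size_diag -(perm_size tD) size_map cardE.
Qed.

Lemma is_tabI la t : {in X &, injective t} ->
  {in X, forall x, (t x).2 < nth 0 la (t x).1} -> #|X| = sumn la ->
  is_tab la t.
Proof.
move=> tinj tD cX; have ut : uniq [seq t x | x <- enum X].
  by rewrite map_inj_in_uniq ?enum_uniq // => x y; rewrite !mem_enum; apply: tinj.
apply: uniq_perm; rewrite ?diag_uniq //.
have [p /mapP[x]||] // := uniq_min_size ut (s2 := diag la).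
  by rewrite mem_enum => xX ->; rewrite mem_diag tD.
by rewrite size_map -cardE cX size_diag.
Qed.

Lemma tab_perm la t t' : is_tab la t -> is_tab la t' ->
  exists2 s, s \in Sym X & {in X, forall x, t' (s x) = t x}.
Proof.
(* The default value makes [f] the identity outside [X]. *)
move=> tD tD'; pose f x := odflt x [pick y in X | (x \in X) && (t' y == t x)].
have fX x : x \in X -> f x \in X /\ t' (f x) = t x.
  move=> xX; rewrite /f; case: pickP => [y /and3P[yX _ /eqP] //|no].
  have: t x \in [seq t' x | x <- enum X].
    by rewrite (perm_mem tD') mem_diag (tab_mem tD).
  case/mapP=> y; rewrite mem_enum => yX e.
  by have := no y; rewrite yX xX e eqxx.
have fN x : x \notin X -> f x = x.
  by move=> /negPf xX; rewrite /f; case: pickP => // y; rewrite xX andbF.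
have finj : injective f.
  move=> x y e; have [xX|xX] := boolP (x \in X); have [yX|yX] := boolP (y \in X).
  - by apply: (tab_inj tD) => //; rewrite -(fX x xX).2 -(fX y yX).2 e.
  - by move: (fX x xX).1; rewrite e fN // (negPf yX).
  - by move: (fX y yX).1; rewrite -e fN // (negPf xX).
  - by rewrite -(fN x xX) -(fN y yX).
exists (perm finj) => [|x xX]; last by rewrite permE (fX x xX).2.
rewrite inE; apply/subsetP=> x; rewrite inE permE.
by apply: contraR => /fN->.
Qed.

Definition stab r : {set {perm T}} :=
  [set s in Sym X | [forall x in X, r (s x) == r x]].

Lemma stabP r s :
  reflect (s \in Sym X /\ {in X, forall x, r (s x) = r x}) (s \in stab r).
Proof.
apply: (iffP setIdP) => -[sX rs]; split=> //.
  by move=> x xX; apply/eqP/(forall_inP rs).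
by apply/forall_inP=> x xX; apply/eqP/rs.
Qed.

Lemma Sym_closed s x : s \in Sym X -> (s x \in X) = (x \in X).
Proof. by rewrite inE; apply: perm_closed. Qed.

Lemma stab_group_set r : group_set (stab r).
Proof.
apply/group_setP; split=> [|s s' /stabP[sX rs] /stabP[sX' rs']].
  by apply/stabP; split=> [|x _]; rewrite ?group1 ?perm1.
apply/stabP; split=> [|x xX]; first by rewrite groupM.
by rewrite permM rs' ?rs // Sym_closed.
Qed.
Canonical stab_group r := Group (stab_group_set r).

Lemma stab_Sym r s : s \in stab r -> s \in Sym X.
Proof. by case/stabP. Qed.

Lemma tperm_stab r x y : x \in X -> y \in X -> r x = r y ->
  tperm x y \in stab r.
Proof.
move=> xX yX rxy; apply/stabP; split=> [|z zX]; last by case: tpermP => // ->.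
rewrite inE; apply: subset_trans (tperm_on x y) _.
by apply/subsetP=> z /set2P[] ->.
Qed.

Lemma stab_row_col la t s : is_tab la t ->
  s \in stab (fun x => (t x).1) -> s \in stab (fun x => (t x).2) -> s = 1%g.
Proof.
move=> tD /stabP[sX s1] /stabP[_ s2]; apply/permP=> x; rewrite perm1.
have [xX|xX] := boolP (x \in X); last by move: sX; rewrite inE => /out_perm->.
apply: (tab_inj tD); rewrite ?Sym_closed //.
by rewrite [LHS]surjective_pairing s1 // s2 // -surjective_pairing.
Qed.

(* The pairs in the same row of [t] but the same column of [t' \o g] are what
   makes [a_t * g * b_t'] vanish. *)
Definition collision t t' (g : {perm T}) :=
  [exists x in X, exists y in X,
     [&& x != y, (t x).1 == (t y).1 & (t' (g x)).2 == (t' (g y)).2]].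

Lemma collisionPn t t' g : ~~ collision t t' g ->
  {in X &, forall x y, (t x).1 = (t y).1 -> (t' (g x)).2 = (t' (g y)).2 -> x = y}.
Proof.
move=> /exists_inPn nc x y xX yX e1 e2; apply/eqP; apply: contraT => xy.
by move/exists_inPn: (nc x xX) => /(_ y yX); rewrite xy e1 e2 !eqxx.
Qed.

(** Without a collision the entries of one row of [t] go to distinct columns, so at most [j] of them
    reach the first [j] columns. *)
Lemma card_row_col la mu t t' g i j :
    is_tab la t -> is_tab mu t' -> ~~ collision t t' g ->
  #|[set x in X | ((t x).1 == i) && ((t' (g x)).2 < j)]| <= minn (nth 0 la i) j.
Proof.
move=> tD tD' nc; rewrite leq_min; apply/andP; split.
  rewrite -count_diag_row -(tab_count _ tD); apply/subset_leq_card/subsetP=> x.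
  by rewrite !inE => /and3P[-> ->].
case: j => [|j].
  by rewrite leqn0 cards_eq0; apply/eqP/setP=> x; rewrite !inE ltn0 !andbF.
set A := [set x in _ | _]; pose f x : 'I_j.+1 := inord (t' (g x)).2.
rewrite -[j.+1 in leqRHS]card_ord -(card_in_imset (f := f) (D := A)) ?max_card //.
move=> x y; rewrite !inE => /and3P[xX /eqP rx cx] /and3P[yX /eqP ry cy].
move/(congr1 val); rewrite /f /= !inordK // => e.
by apply: (collisionPn nc) => //; rewrite rx ry.
Qed.

Lemma card_partition_rows la t (A : {set T}) : is_tab la t -> A \subset X ->
  #|A| = \sum_(i < size la) #|[set x in A | (t x).1 == i]|.
Proof.
move=> tD /subsetP AX; rewrite -sum1_card.
have lt x : x \in A -> (t x).1 < size la.
  move=> xA; have := tab_mem tD (AX x xA).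
  case: (ltnP (t x).1 (size la)) => // le.
  by rewrite nth_default.
case: (posnP (size la)) => [s0|s0].
  rewrite big1; last by move=> x /lt; rewrite s0.
  by rewrite big1 // => -[i ilt]; exfalso; rewrite s0 in ilt.
rewrite (partition_big (fun x => insubd (Ordinal s0) (t x).1) predT) //=.
apply: eq_bigr => i _; rewrite -sum1_card; apply: eq_bigl => x; rewrite inE.
have [xA|//] := boolP (x \in A); rewrite /= -val_eqE /= val_insubd lt //.
Qed.

Lemma sum_card_row_col la mu t t' g j :
    is_tab la t -> is_tab mu t' -> g \in Sym X ->
  \sum_(i < size la) #|[set x in X | ((t x).1 == i) && ((t' (g x)).2 < j)]|
    = colsum mu j.
Proof.
move=> tD tD' gX; rewrite /colsum -(tab_count _ tD').
have <- : #|[set x in X | (t' (g x)).2 < j]| = #|[set x in X | (t' x).2 < j]|.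
  rewrite -(card_imset _ (@perm_inj _ g)); apply: eq_card => x; rewrite inE.
  apply/imsetP/idP=> [[y /setIdP[yX yj] ->]|/andP[xX xj]].
    by rewrite Sym_closed ?yX.
  exists (g^-1 x)%g; last by rewrite permKV.
  by rewrite inE permKV xj Sym_closed ?groupV ?xX.
rewrite (card_partition_rows tD); last by apply/subsetP=> x /setIdP[].
by apply: eq_bigr => i _; apply: eq_card => x; rewrite !inE andbAC -andbA.
Qed.

(** Adding the bounds of [card_row_col] over the rows of [t] gives one half of a dominance
    comparison; two different shapes therefore always collide in at least one of the two orders. *)
Lemma collision_colsum la mu t t' g j :
    is_tab la t -> is_tab mu t' -> g \in Sym X -> ~~ collision t t' g ->
  colsum mu j <= colsum la j.
Proof.
move=> tD tD' gX nc; rewrite -(sum_card_row_col j tD tD' gX) colsumE [leqRHS](big_nth 0).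
by rewrite big_mkord; apply: leq_sum => i _; apply: (card_row_col _ _ tD tD' nc).
Qed.

(* Equality in the column counts of [collision_colsum] forces the map
   x |-> (row of x in t, column of g x in t) to be a tableau again. *)
Lemma no_collision_factor la t g :
    is_tab la t -> g \in Sym X -> ~~ collision t t g ->
  exists2 p, p \in stab (fun x => (t x).1) & (p^-1 * g)%g \in stab (fun x => (t x).2).
Proof.
move=> tD gX nc; pose u x := ((t x).1, (t (g x)).2).
have uD : is_tab la u.
  apply: is_tabI => [x y xX yX [] /(collisionPn nc)|x xX|]; last exact: tab_card tD.
    by move=> inj /inj; apply.
  rewrite /u /=; set i := (t x).1; set j := nth 0 la i.
  (* With [j] the length of row [i], equality of the totals makes every row bound an equality, so
     the whole of row [i] lands in the first [j] columns. *)
  have : #|[set x in X | ((t x).1 == i) && ((t (g x)).2 < j)]| = j.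
    pose E (k : 'I_(size la)) := #|[set x in X | ((t x).1 == k) && ((t (g x)).2 < j)]|.
    have leE k : E k <= minn (nth 0 la k) j ?= iff (E k == minn (nth 0 la k) j).
      exact/leqif_eq/(card_row_col k j tD tD nc).
    have [_] := leqif_sum (fun k (_ : true) => leE k).
    have -> : \sum_k E k = \sum_(k < size la) minn (nth 0 la k) j.
      by rewrite (sum_card_row_col j tD tD gX) colsumE [LHS](big_nth 0) big_mkord.
    rewrite eqxx => /esym/forallP eE.
    have [ilt|ige] := ltnP i (size la).
      by have /eqP := eE (Ordinal ilt); rewrite /E /= minnn.
    by move: (tab_mem tD xX); rewrite -/i nth_default.
  rewrite -[X in _ = X]count_diag_row -(tab_count _ tD).
  move/eqP; rewrite eqn_leq => /andP[_ cle].
  set A := [set x in _ | _] in cle; set B := [set x in _ | _] in cle.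
  have /setP/(_ x) : B = A.
    apply/eqP; rewrite eqEcard cle andbT.
    by apply/subsetP=> y; rewrite !inE => /and3P[-> ->].
  by rewrite !inE xX eqxx.
(* As [u] and [t] have the same rows, the permutation matching them preserves rows; comparing second
   coordinates, the rest of [g] preserves columns. *)
have [p pX pt] := tab_perm uD tD.
exists p.
  by apply/stabP; split=> // x xX; rewrite pt.
apply/stabP; split=> [|x xX]; first by rewrite groupM ?groupV.
have yX : (p^-1 x)%g \in X by rewrite Sym_closed ?groupV.
by rewrite permM -[x in RHS](permKV p) pt.
Qed.

End Tableau.

(** First differences of [colsum] count the parts larger than [j], second differences give the
    multiplicities of the parts, and a sorted list is determined by its multiplicities. *)
Lemma colsum_inj la mu :
  is_part la -> is_part mu -> colsum la =1 colsum mu -> la = mu.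
Proof.
move=> /andP[sla zla] /andP[smu zmu] e.
have cS nu j : colsum nu j.+1 = (colsum nu j + count (fun v => j < v) nu)%N.
  rewrite !colsumE -sum1_count [X in (_ + X)%N]big_mkcond -big_split /=.
  by apply: eq_bigr => v _; case: (ltnP j v) => ?; lia.
have cE j : count (fun v => j < v)%N la = count (fun v => j < v)%N mu.
  by apply: (@addnI (colsum la j)); rewrite -cS e cS e.
apply: (sorted_eq _ _ sla smu) => [x y z /[swap]|x y|]; first exact: leq_trans.
  by case/andP=> /= yx xy; apply/eqP; rewrite eqn_leq xy.
have cm nu v : (count (fun u => v < u) nu
   = count (fun u => v.+1 < u) nu + count_mem v.+1 nu)%N.
  rewrite -(count_predUI (fun u => v.+1 < u)%N) -[LHS]addn0; congr addn.
    by apply: eq_count => u; rewrite /= orbC eq_sym -leq_eqVlt.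
  rewrite (eq_count (a2 := pred0)) ?count_pred0 // => u /=.
  by case: ltngtP => // ->; rewrite andbF.
apply/allP=> -[_|v _]; first by rewrite /= !(count_memPn _).
by apply/eqP/(@addnI (count (fun u => v.+1 < u)%N la)); rewrite -cm cE cm cE.
Qed.

(** * Young symmetrizers *)

Section Young.

Variables (F : numFieldType) (T : finType).
Local Notation A := (galg F {perm T}).
Local Notation de := (gdelta F).
Implicit Types (X : {set T}) (t : T -> nat * nat) (r : T -> nat).
Implicit Types (la mu : seq nat).

Definition row_of t x := (t x).1.
Definition col_of t x := (t x).2.

Definition rsym X r : A := \sum_(p in stab X r) de p.
Definition csym X r : A := \sum_(q in stab X r) (-1) ^+ odd_perm q *: de q.
Definition young X t : A := rsym X (row_of t) * csym X (col_of t).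

Lemma rsymM X r p : p \in stab X r -> rsym X r * de p = rsym X r.
Proof.
move=> pX; rewrite /rsym mulr_suml [RHS](reindex_inj (mulIg p)) /=.
by apply: eq_big => [q|q _]; rewrite ?groupMr // -gdeltaM.
Qed.

Lemma csymM X r q :
  q \in stab X r -> de q * csym X r = (-1) ^+ odd_perm q *: csym X r.
Proof.
move=> qX; rewrite /csym mulr_sumr scaler_sumr [RHS](reindex_inj (mulgI q)) /=.
apply: eq_big => [p|p _]; first by rewrite groupMl.
by rewrite -scalerAr -gdeltaM odd_permM signr_addb scalerA signrMK.
Qed.

Lemma rsym_supp X r : rsym X r \in gsupp (Sym_group X).
Proof. by apply: rpred_sum => p /stab_Sym pX; apply: gsupp_delta. Qed.

Lemma csym_supp X r : csym X r \in gsupp (Sym_group X).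
Proof.
by apply: rpred_sum => p /stab_Sym pX; apply/gsuppZ/gsupp_delta.
Qed.

Lemma young_supp X t : young X t \in gsupp (Sym_group X).
Proof. by rewrite rpredM ?rsym_supp ?csym_supp. Qed.

Lemma rsymE X r g : rsym X r g = (g \in stab X r)%:R.
Proof.
rewrite galg_sumE; have [gX|gX] := boolP (g \in stab X r).
  rewrite (bigD1 g) //= ffunE eqxx big1 ?addr0 // => p /andP[_ pg].
  by rewrite ffunE eq_sym (negPf pg).
rewrite big1 // => p pX; rewrite ffunE; case: eqP => // gp.
by rewrite gp pX in gX.
Qed.

Lemma csymE X r g : csym X r g = (g \in stab X r)%:R * (-1) ^+ odd_perm g.
Proof.
rewrite galg_sumE; have [gX|gX] := boolP (g \in stab X r).
  rewrite (bigD1 g) //= galgZE ffunE eqxx mulr1 mul1r big1 ?addr0 // => p.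
  by case/andP=> _ pg; rewrite galgZE ffunE eq_sym (negPf pg) mulr0.
rewrite mul0r big1 // => p pX; rewrite galgZE ffunE; case: eqP => [gp|]; last by rewrite mulr0.
by rewrite gp pX in gX.
Qed.

Lemma youngE X t g : young X t g = \sum_h
  (h \in stab X (row_of t))%:R * ((h^-1 * g)%g \in stab X (col_of t))%:R
    * (-1) ^+ odd_perm (h^-1 * g)%g.
Proof. by rewrite galgME; apply: eq_bigr => h _; rewrite rsymE csymE mulrA. Qed.

(** Row and column stabilizers meet only in the identity. This normalization lets [gtau] read off
    every scalar by which a Young symmetrizer gets multiplied. *)
Lemma gtau_young X la t : is_tab X la t -> gtau (young X t) = 1.
Proof.
move=> tD; rewrite /gtau youngE (bigD1 1%g) //= invg1 mulg1 odd_perm1 !group1.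
rewrite !mulr1 big1 ?addr0 // => p p1; rewrite mulg1 groupV -natrM mulnb.
case: andP => [[/(stab_row_col tD) p1' /p1' e]|]; last by rewrite mul0r.
by rewrite e eqxx in p1.
Qed.

(** The transposition of the colliding pair is absorbed by the row symmetrizer, while its conjugate
    by [g] changes the sign of the column antisymmetrizer. *)
Lemma collision_vanish X t t' g : g \in Sym X -> collision X t t' g ->
  rsym X (row_of t) * de g * csym X (col_of t') = 0.
Proof.
move=> gX /exists_inP[x xX /exists_inP[y yX /and3P[xy /eqP rxy /eqP cxy]]].
have tau_r : tperm x y \in stab X (row_of t) by apply: tperm_stab.
have tau_c : tperm (g x) (g y) \in stab X (col_of t').
  by apply: tperm_stab; rewrite ?(Sym_closed _ gX).
set b := csym _ _; set a := rsym _ _; set z := a * _ * b.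
have : z = - z.
  rewrite {1}/z /a -{1}(rsymM tau_r) -!mulrA (mulrA (de _)) -gdeltaM conjgC tpermJ.
  rewrite gdeltaM -(mulrA (de g)) csymM // odd_tperm (inj_eq perm_inj) xy.
  by rewrite scaleN1r !mulrN /z /a mulrA.
move/eqP; rewrite -addr_eq0 -mulr2n -scaler_nat scaler_eq0 pnatr_eq0 /=.
by move/eqP.
Qed.

(** Von Neumann's lemma: for each [g], either a collision kills the term, or [g] is a row
    permutation times a column permutation and both are absorbed up to a sign. *)
Lemma young_span X la t x : is_tab X la t -> x \in gsupp (Sym_group X) ->
  exists l, rsym X (row_of t) * x * csym X (col_of t) = l *: young X t.
Proof.
move=> tD xX; rewrite (gsupp_expand_mul _ _ xX).
apply: (big_ind (fun z => exists l, z = l *: young X t)) => [|_ _ [l ->] [m ->]|g gX].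
- by exists 0; rewrite scale0r.
- by exists (l + m); rewrite scalerDl.
have [cg|nc] := boolP (collision X t t g).
  by exists 0; rewrite (collision_vanish gX cg) scaler0 scale0r.
have [p pr pc] := no_collision_factor tD gX nc.
exists (x g * (-1) ^+ odd_perm (p^-1 * g)); rewrite -scalerA; congr (_ *: _).
by rewrite -{1}(mulKVg p g) gdeltaM mulrA rsymM // -mulrA csymM // -scalerAr.
Qed.

Lemma young_sandwich X la t x : is_tab X la t -> x \in gsupp (Sym_group X) ->
  young X t * x * young X t = gtau (young X t * x * young X t) *: young X t.
Proof.
move=> tD xX.
have yX : csym X (col_of t) * x * rsym X (row_of t) \in gsupp (Sym_group X).
  by rewrite !rpredM ?csym_supp ?rsym_supp.
have [l e] := young_span tD yX.
suff -> : young X t * x * young X t = l *: young X t.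
  by rewrite gtauZ (gtau_young tD) mulr1.
by rewrite -e /young !mulrA.
Qed.

(** Only one order of the product is controlled, depending on how the shapes compare; the
    commutation property of [ychar] removes this asymmetry in [ychar_orth]. *)
Lemma young_orth X la mu t t' : is_part la -> is_part mu -> la <> mu ->
    is_tab X la t -> is_tab X mu t' ->
  (forall x, x \in gsupp (Sym_group X) -> young X t * x * young X t' = 0) \/
  (forall x, x \in gsupp (Sym_group X) -> young X t' * x * young X t = 0).
Proof.
move=> pla pmu ne tD tD'.
have vanish t1 t2 : [forall g in Sym X, collision X t1 t2 g] ->
    forall x, x \in gsupp (Sym_group X) -> young X t1 * x * young X t2 = 0.
  move=> /forall_inP coll x xX.
  have yX : csym X (col_of t1) * x * rsym X (row_of t2) \in gsupp (Sym_group X).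
    by rewrite !rpredM ?csym_supp ?rsym_supp.
  rewrite /young !mulrA -2!(mulrA (rsym X _)) (gsupp_expand_mul _ _ yX).
  by rewrite big1 // => g gX; rewrite collision_vanish ?scaler0 ?coll.
have [/vanish|/forall_inPn[g gX nc]] := boolP [forall g in Sym X, collision X t t' g].
  by left.
have [/vanish|/forall_inPn[g' gX' nc']] := boolP [forall g in Sym X, collision X t' t g].
  by right.
case: ne; apply: colsum_inj => // j; apply/eqP; rewrite eqn_leq.
by rewrite (collision_colsum _ tD tD' gX nc) (collision_colsum _ tD' tD gX' nc').
Qed.

(** * The central elements [sum_s chi(s) s] *)

(** The scalar [h] in [c * c = h c], read off at the identity, where [c] has coefficient 1;
    classically the product of the hook lengths. *)
Definition hook X t : F := gtau (young X t * young X t).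
Definition ydim X t : nat := \rank (gopmx (Sym_group X) (young X t) 1).
Definition ychar X t : A :=
  (hook X t)^-1 *: \sum_(g in Sym X) de g^-1 * young X t * de g.

Section OneTableau.

Variables (X : {set T}) (la : seq nat) (t : T -> nat * nat).
Hypothesis tD : is_tab X la t.

Lemma young_sqr : young X t * young X t = hook X t *: young X t.
Proof. by have := young_sandwich tD (rpred1 _); rewrite !mulr1. Qed.

(** The trace of left multiplication by [c] is computed twice: as [h] times a rank, and as [#|X|!]
    times the identity coefficient of [c]. *)
Lemma hook_ydim : hook X t * (ydim X t)%:R = (#|X|`!)%:R.
Proof.
rewrite -mxtrace_quasi_idem; last first.
  by rewrite gopmxM ?young_supp ?rpred1 // young_sqr gopmxZ mulr1.
rewrite gopmx_tr mulr1 gtau_sum.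
under eq_bigr => g _.
  rewrite gtau_mulC mulrA -gdeltaM mulgV gdelta1 mul1r (gtau_young tD); over.
by rewrite sumr_const card_Sym.
Qed.

Lemma hook_gt0 : 0 < hook X t.
Proof.
have := hook_ydim; case: (ydim X t) => [|d] e.
  by move/eqP: e; rewrite mulr0 eq_sym pnatr_eq0 (gtn_eqF (fact_gt0 _)).
have d0 : 0 < d.+1%:R :> F by rewrite ltr0n.
by rewrite -(pmulr_lgt0 _ d0) e ltr0n fact_gt0.
Qed.

Lemma hook_neq0 : hook X t != 0.
Proof. exact: lt0r_neq0 hook_gt0. Qed.

Lemma ydim_gt0 : (0 < ydim X t)%N.
Proof.
rewrite lt0n; apply/eqP=> d0; have := hook_ydim; rewrite d0 mulr0.
by move/eqP; rewrite eq_sym pnatr_eq0 (gtn_eqF (fact_gt0 _)).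
Qed.

Lemma ychar_supp : ychar X t \in gsupp (Sym_group X).
Proof.
apply/gsuppZ/rpred_sum => g gX.
by rewrite rpredM ?gsupp_delta // rpredM ?gsupp_delta ?groupV ?young_supp.
Qed.

Lemma ychar_conj s : s \in Sym X -> de s^-1 * ychar X t * de s = ychar X t.
Proof.
move=> sX; rewrite /ychar -scalerAr -scalerAl mulr_sumr mulr_suml.
congr (_ *: _); rewrite [RHS](reindex_inj (mulIg s)) /=.
apply: eq_big => [g|g _]; first by rewrite groupMr.
by rewrite invMg !gdeltaM !mulrA.
Qed.

Lemma ychar_comm x : x \in gsupp (Sym_group X) ->
  x * ychar X t = ychar X t * x.
Proof.
move=> xX; apply: (gsupp_comm xX) => g gX.
by rewrite -{1}(ychar_conj gX) !mulrA -gdeltaM mulgV gdelta1 mul1r.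
Qed.

(** Each [c g^-1 c] equals [h c(g)] times [c] by the sandwich property, so the sum of conjugates
    reassembles to [c * c]. *)
Lemma young_ychar : young X t * ychar X t = hook X t *: young X t.
Proof.
rewrite -young_sqr -scalerAr mulr_sumr.
rewrite -[RHS]mulr1 (gsupp_expand_mul _ _ (young_supp X t)) scaler_sumr.
apply: eq_bigr => g gX; rewrite mulr1 2!mulrA (young_sandwich tD); last first.
  by rewrite gsupp_delta ?groupV.
have -> : gtau (young X t * de g^-1 * young X t) = hook X t * young X t g.
  by rewrite gtau_mulC mulrA young_sqr -scalerAl gtauZ gtau_delta.
by rewrite -scalerAl scalerA mulKf ?hook_neq0.
Qed.

Lemma ychar_mull x : (forall g, g \in Sym X -> x * de g = de g * x) ->
  x * ychar X t = (hook X t)^-1 *: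
    \sum_(g in Sym X) de g^-1 * (x * young X t) * de g.
Proof.
move=> xC; rewrite -scalerAr mulr_sumr; congr (_ *: _); apply: eq_bigr => g gX.
by rewrite !mulrA xC ?groupV.
Qed.

Lemma ychar_sqr : ychar X t * ychar X t = hook X t *: ychar X t.
Proof.
rewrite ychar_mull => [|g gX]; last by rewrite -ychar_comm ?gsupp_delta.
rewrite -ychar_comm ?young_supp // young_ychar [in RHS]/ychar scalerA mulrC.
rewrite -scalerA; congr (_ *: _); rewrite scaler_sumr.
by apply: eq_bigr => g _; rewrite -scalerAr -scalerAl.
Qed.

Lemma gtau_ychar : gtau (ychar X t) = (ydim X t)%:R.
Proof.
rewrite gtauZ gtau_sum; apply: (mulfI hook_neq0); rewrite hook_ydim mulrA.
rewrite mulfV ?hook_neq0 // mul1r.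
under eq_bigr => g _.
  rewrite gtau_mulC mulrA -gdeltaM mulgV gdelta1 mul1r (gtau_young tD); over.
by rewrite sumr_const card_Sym.
Qed.

End OneTableau.

Lemma ychar_orth X la mu t t' : is_part la -> is_part mu -> la <> mu ->
  is_tab X la t -> is_tab X mu t' -> ychar X t * ychar X t' = 0.
Proof.
move=> pla pmu ne tD tD'.
have orth u u' : (forall x, x \in gsupp (Sym_group X) ->
    young X u * x * young X u' = 0) -> ychar X u * ychar X u' = 0.
  rewrite /ychar; move: (young X u) (young X u') => y y' o.
  rewrite -scalerAr -scalerAl mulr_suml big1 ?scaler0 // => g gX.
  rewrite mulr_sumr big1 // => h hX.
  rewrite -!mulrA (mulrA (de g)) -gdeltaM (mulrA y) (mulrA (y * _)) o.
    by rewrite mul0r mulr0.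
  by rewrite gsupp_delta ?groupM ?groupV.
case: (young_orth pla pmu ne tD tD') => [/orth //|/orth e].
by rewrite (ychar_comm t' (ychar_supp X t)) e.
Qed.

(** * Renaming the points, and independence of the tableau *)

Lemma Sym_conj X (s p : {perm T}) : (p ^ s \in Sym (s @: X))%g = (p \in Sym X).
Proof.
rewrite !inE; apply/subsetP/subsetP=> sub x; rewrite inE => px.
  have := sub (s x); rewrite inE permJ (inj_eq perm_inj) mem_imset; last exact: perm_inj.
  exact.
rewrite -(permKV s x) mem_imset; last exact: perm_inj.
apply: sub; rewrite inE; apply: contraNneq px => px.
by rewrite -{1}(permKV s x) permJ px permKV.
Qed.

Lemma stab_conj X r r' (s p : {perm T}) : {in X, forall x, r' (s x) = r x} ->
  (p ^ s \in stab (s @: X) r')%g = (p \in stab X r).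
Proof.
move=> rr'; apply/stabP/stabP=> -[]; rewrite Sym_conj => pX pr; split=> // x xX.
  by rewrite -!rr' ?Sym_closed // -permJ pr // imset_f.
case/imsetP: xX => y yX ->{x}.
by rewrite permJ !rr' ?Sym_closed // pr.
Qed.

Lemma ychar_move X t t' (s : {perm T}) : {in X, forall x, t' (s x) = t x} ->
  ychar (s @: X) t' = de s^-1 * ychar X t * de s.
Proof.
move=> tt'.
have yJ : young (s @: X) t' = de s^-1 * young X t * de s.
  have rJ : rsym (s @: X) (row_of t') = de s^-1 * rsym X (row_of t) * de s.
    rewrite /rsym mulr_sumr mulr_suml (reindex_inj (conjg_inj s)) /=.
    apply: eq_big => [p|p _]; last by rewrite -!gdeltaM -mulgA.
    by apply: stab_conj => x xX; rewrite /row_of tt'.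
  have cJ : csym (s @: X) (col_of t') = de s^-1 * csym X (col_of t) * de s.
    rewrite /csym mulr_sumr mulr_suml (reindex_inj (conjg_inj s)) /=.
    apply: eq_big => [p|p _].
      by apply: stab_conj => x xX; rewrite /col_of tt'.
    by rewrite odd_permJ -scalerAr -scalerAl -!gdeltaM -mulgA.
  rewrite /young rJ cJ; move: (rsym _ _) (csym _ _) => a b.
  by rewrite !mulrA -(mulrA _ (de s)) -gdeltaM mulgV gdelta1 mulr1.
have hJ : hook (s @: X) t' = hook X t.
  rewrite /hook yJ; move: (young _ _) => y.
  rewrite -!mulrA (mulrA (de s)) -gdeltaM mulgV gdelta1 mul1r.
  by rewrite gtau_mulC -!mulrA -gdeltaM mulgV gdelta1 mulr1.
rewrite /ychar hJ yJ; move: (young X t) => y.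
rewrite -scalerAr -scalerAl mulr_sumr mulr_suml; congr (_ *: _).
rewrite (reindex_inj (conjg_inj s)) /=; apply: eq_big => [g|g _].
  by rewrite Sym_conj.
rewrite !mulrA -!gdeltaM -!mulrA -!gdeltaM.
by rewrite -!invMg -conjgC.
Qed.

(** Changing the tableau on a fixed [X] conjugates by an element of [Sym X], which fixes [ychar]. A
    tableau adapted to a smaller set may thus replace the canonical one. *)
Lemma ychar_uniq X la t t' : is_tab X la t -> is_tab X la t' ->
  ychar X t = ychar X t'.
Proof.
move=> tD tD'; have [s sX tt'] := tab_perm tD tD'.
rewrite -(ychar_conj t sX) -(ychar_move tt') im_perm_on //.
by rewrite inE in sX.
Qed.

Lemma hookE X la t : is_tab X la t -> hook X t = (#|X|`!)%:R / (ydim X t)%:R.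
Proof.
move=> tD; rewrite -(hook_ydim tD) mulfK // pnatr_eq0 -lt0n.
exact: ydim_gt0 tD.
Qed.

(* The coefficients of [b * a] are those of [a * b] at the inverses, and [a * b]
   and [b * a] have the same sum of conjugates. *)
Lemma ychar_inv X t g : ychar X t g^-1%g = ychar X t g.
Proof.
rewrite /ychar !galgZE; congr (_ * _).
have yV s : young X t s^-1%g = (csym X (col_of t) * rsym X (row_of t)) s.
  rewrite !galgME [RHS](reindex_inj (mulgI s)) /=; apply: eq_bigr => h _.
  rewrite mulrC !rsymE !csymE -invMg.
  by rewrite groupV odd_permV invMg mulgKV groupV.
have abC : \sum_(k in Sym X) de k^-1 * young X t * de k =
    \sum_(k in Sym X) de k^-1 * (csym X (col_of t) * rsym X (row_of t)) * de k.
  rewrite /young; have := csym_supp X (col_of t).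
  move: (rsym _ _) (csym _ _) => a b bX; apply/ffunP=> s.
  rewrite -!gtau_delta !mulr_suml !gtau_sum.
  pose z := \sum_(k in Sym X) de k * de s^-1 * de k^-1.
  have toz y : \sum_(k in Sym X) gtau (de k^-1 * y * de k * de s^-1) = gtau (y * z).
    rewrite mulr_sumr gtau_sum; apply: eq_bigr => k _.
    by rewrite -!mulrA gtau_mulC -!mulrA.
  have bz : b * z = z * b.
    apply: (gsupp_comm bX) => k kX; rewrite mulr_sumr mulr_suml.
    rewrite [RHS](reindex_inj (mulgI k)) /=; apply: eq_big => [j|j _].
      by rewrite groupMl.
    by rewrite -!gdeltaM invMg !mulgA mulgKV.
  by rewrite !toz -(mulrA a) bz mulrA [LHS]gtau_mulC mulrA.
rewrite {1}abC !galg_sumE; apply: eq_bigr => k _.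
by rewrite !galg_mul_deltaE !gdelta_mulE -yV !invMg !invgK !mulgA.
Qed.

(** Together with [ychar_inv] this makes [ychar] self-adjoint. *)
Lemma ychar_real X t g : ychar X t g \is Num.real.
Proof.
have yR s : young X t s \is Num.real.
  rewrite youngE; apply: rpred_sum => h _.
  by rewrite !rpredM ?realn ?rpredX ?rpredN ?rpred1.
rewrite galgZE rpredM ?rpredV //.
  rewrite /hook /gtau galgME; apply: rpred_sum => h _; exact: rpredM.
rewrite galg_sumE; apply: rpred_sum => h _.
by rewrite galg_mul_deltaE gdelta_mulE.
Qed.

End Young.

(** * Counting standard tableaux *)

Section RowLengths.

Local Open Scope nat_scope.

Implicit Types (phi psi : nat -> nat) (i j n N : nat).

(** Shapes are treated as row-length functions here, so that adding and removing boxes are pointwise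
    operations without trailing zeros to trim. *)
Definition inc phi i := fun j => phi j + (j == i).
Definition dec phi i := fun j => phi j - (j == i).
Definition addable phi i := (i == 0) || (phi i < phi i.-1).
Definition removable phi i := phi i.+1 < phi i.

(* Number of standard tableaux with row lengths [phi], where [n] is the size of
   the diagram and [N] bounds its number of rows. *)
Fixpoint syt N n phi : nat :=
  if n is n'.+1 then \sum_(j < N | removable phi j) syt N n' (dec phi j) else 1.

Lemma sytS N n phi :
  syt N n.+1 phi = \sum_(j < N | removable phi j) syt N n (dec phi j).
Proof. by []. Qed.

Arguments syt : simpl never.

Lemma eq_syt N n phi psi : phi =1 psi -> syt N n phi = syt N n psi.
Proof.
elim: n phi psi => // n IH phi psi e; apply: eq_big => [j|j _].
  by rewrite /removable !e.
by apply: IH => i; rewrite /dec e.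
Qed.

Lemma count_addable N phi : phi N = 0 ->
  \sum_(i < N.+1) addable phi i = (\sum_(i < N.+1) removable phi i).+1.
Proof.
move=> phiN; rewrite big_ord_recl big_ord_recr /= {2}/removable phiN ltn0 addn0.
by rewrite add1n.
Qed.

Lemma addable_removable phi i j : i != j ->
  addable phi i && removable (inc phi i) j =
  removable phi j && addable (dec phi j) i.
Proof.
rewrite /addable /removable /inc /dec => ij.
case: i ij => [|i] ij /=; first by rewrite andbT; lia.
by case: (i =P j) => [<-|]; lia.
Qed.

(* Up-down duality in Young's lattice: adding a box and then removing a
   different one commutes, and there is one more addable than removable box. *)
Lemma sum_syt_addable N n phi : (forall i, phi i.+1 <= phi i) -> phi N = 0 ->
  \sum_(i < N.+1) phi i = n ->
  \sum_(i < N.+1 | addable phi i) syt N.+1 n.+1 (inc phi i)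
    = n.+1 * syt N.+1 n phi.
Proof.
elim: n phi => [|n IH] phi mono phiN sz.
  have phi0 (i : 'I_N.+1) : phi i = 0.
    by apply/eqP; rewrite -leqn0 -sz (bigD1 i) //= leq_addr.
  rewrite (bigD1 ord0) //= [X in _ + X]big1 ?addn0 ?sytS.
    have r0 : removable (inc phi 0) 0.
      by rewrite /removable /inc addn0 (leq_ltn_trans (mono 0)) // (phi0 ord0).
    rewrite (bigD1 ord0) //= big1 // => i; rewrite -val_eqE /= => /andP[].
    by rewrite /removable /inc; have := phi0 i; lia.
  move=> i; rewrite /addable -val_eqE /= => /andP[ai /negPf i0].
  move: ai; rewrite i0 /= phi0.
  by rewrite (phi0 (Ordinal (leq_ltn_trans (leq_pred i) (ltn_ord i)))).
set S := syt N.+1 n.+1.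
(* In this sum and the next the terms with [i = j] give back [phi], once per addable and once per
   removable box; the other terms agree by [addable_removable]. *)
have lhs : \sum_(i < N.+1 | addable phi i) syt N.+1 n.+2 (inc phi i) =
    (\sum_(i < N.+1) addable phi i) * S phi +
    \sum_(i < N.+1) \sum_(j < N.+1 | i != j)
       (addable phi i && removable (inc phi i) j) * S (dec (inc phi i) j).
  rewrite big_distrl -big_split big_mkcond; apply: eq_bigr => i _ /=.
  case: ifP => [ai|ai]; last by rewrite mul0n big1.
  rewrite sytS (bigD1 i) /=; last by rewrite /removable /inc eqxx addn1; have := mono i; lia.
  congr (_ + _).
    by rewrite mul1n; apply: eq_syt => j; rewrite /dec /inc addnK.
  rewrite big_mkcondr [RHS]big_mkcond big_mkcond /=; apply: eq_bigr => j _.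
  by rewrite eq_sym; case: (i != j); case: removable; rewrite ?mul1n.
have rhs : n.+1 * S phi =
    (\sum_(i < N.+1) removable phi i) * S phi +
    \sum_(j < N.+1) \sum_(i < N.+1 | i != j)
       (removable phi j && addable (dec phi j) i) * S (inc (dec phi j) i).
  rewrite {1}/S sytS big_distrr big_distrl -big_split big_mkcond /=.
  apply: eq_bigr => j _.
  case: ifP => [rj|rj]; last by rewrite mul0n big1.
  have dmono i : dec phi j i.+1 <= dec phi j i.
    by move: rj (mono i); rewrite /removable /dec; case: (i =P j) => [->|]; lia.
  have dN : dec phi j N = 0 by rewrite /dec phiN.
  have dsz : \sum_(i < N.+1) dec phi j i = n.
    move: sz; rewrite (bigD1 j) // [in X in _ -> X](bigD1 j) //=.
    rewrite [in X in _ -> X](eq_bigr (fun i : 'I_N.+1 => phi i)).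
      by move: rj; rewrite /dec /removable; lia.
    by move=> i; rewrite /dec -val_eqE => /negPf->; rewrite subn0.
  rewrite -(IH _ dmono dN dsz).
  rewrite (bigD1 j) /=; last first.
    by rewrite /addable /dec; move: rj; rewrite /removable; case: (val j) => //= i; have := mono i; lia.
  congr (_ + _).
    rewrite mul1n; apply: eq_syt => i; rewrite /dec /inc subnK //.
    by move: rj; rewrite /removable; case: eqP => [->|//]; lia.
  rewrite big_mkcondr [RHS]big_mkcond big_mkcond /=; apply: eq_bigr => i _.
  by case: (i != j); case: addable; rewrite ?mul1n.
rewrite lhs [n.+2 * _]mulSn -/S rhs count_addable // mulSn -addnA; congr (_ + (_ + _)).
rewrite (exchange_big_dep predT) //=; apply: eq_bigr => j _; apply: eq_bigr => i ij.
rewrite addable_removable //; case: andP => [[rj _]|]; rewrite ?mul0n // !mul1n.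
apply: eq_syt => k; rewrite /dec /inc.
by move: rj ij; rewrite /removable -val_eqE /=; do 2!case: eqP => //; lia.
Qed.

End RowLengths.

(** * Partitions *)

Section Partitions.

Local Open Scope nat_scope.

Implicit Types (la mu nu : seq nat) (phi : nat -> nat).

Lemma is_partP la :
  reflect ((forall i, nth 0 la i.+1 <= nth 0 la i) /\
           (forall i, i < size la -> 0 < nth 0 la i)) (is_part la).
Proof.
apply: (iffP andP) => -[].
  move=> sla zla; split=> i; last first.
    by move=> ila; rewrite lt0n; apply: contraNneq zla => <-; apply: mem_nth.
  have [ila|ila] := ltnP i.+1 (size la); last by rewrite nth_default.
  exact: (sortedP 0 sla).
move=> mono pos; split; first by apply/(sortedP 0) => i _; apply: mono.
by apply/(nthP 0) => -[i ila /eqP]; rewrite -leqn0 leqNgt pos.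
Qed.

Lemma part_nth_inj la mu :
  is_part la -> is_part mu -> nth 0 la =1 nth 0 mu -> la = mu.
Proof.
have le_size nu nu' : is_part nu -> nth 0 nu =1 nth 0 nu' -> size nu <= size nu'.
  move=> /is_partP[_ pos] e; rewrite leqNgt; apply/negP => /pos.
  by rewrite e nth_default.
move=> pla pmu e; apply: (@eq_from_nth _ 0) => [|i _]; last exact: e.
by apply/eqP; rewrite eqn_leq !le_size // => i; rewrite e.
Qed.

Lemma sum_nth la n : size la <= n -> \sum_(i < n) nth 0 la i = sumn la.
Proof.
move=> lan; rewrite sumnE (big_nth 0) big_mkord [RHS](big_ord_widen n (nth 0 la)) //.
rewrite [RHS]big_mkcond; apply: eq_bigr => i _.
by case: ltnP => // /(nth_default 0).
Qed.

Lemma size_part la : is_part la -> size la <= sumn la.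
Proof.
move=> /is_partP[_ pos]; rewrite -(sum_nth (leqnn _)) -[X in X <= _]card_ord -sum1_card.
by apply: leq_sum => i _; apply: pos.
Qed.

Lemma part_fun phi n : (forall i, phi i.+1 <= phi i) -> phi n = 0 ->
  exists2 la, is_part la & nth 0 la =1 phi.
Proof.
move=> mono phin.
have mono2 i j : i <= j -> phi j <= phi i.
  elim: j => [|j IH]; first by rewrite leqn0 => /eqP->.
  by rewrite leq_eqVlt => /predU1P[->|/IH] //; apply: leq_trans.
have ex0 : exists i, phi i == 0 by exists n; rewrite phin.
case: (ex_minnP ex0) => m /eqP m0 mmin.
exists (mkseq phi m).
  apply/is_partP; split=> [i|i].
    have [im|im] := ltnP i.+1 m; last by rewrite nth_default ?size_mkseq.
    by rewrite !nth_mkseq // ltnW.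
  rewrite size_mkseq => im; rewrite nth_mkseq // lt0n.
  by apply: contraTneq im => i0; rewrite -leqNgt mmin ?i0.
move=> i; have [im|im] := ltnP i m; first by rewrite nth_mkseq.
rewrite nth_default ?size_mkseq //; apply/esym/eqP; rewrite -leqn0 -m0.
exact: mono2.
Qed.

Lemma mem_add_box la mu : is_part la -> mu \in add_box la ->
  is_part mu /\ exists i, mu = incr_nth la i.
Proof.
by move=> pla; rewrite mem_filter => /andP[pmu /mapP[i _ e]]; split=> //; exists i.
Qed.

Lemma nth_incr la i j : nth 0 (incr_nth la i) j = inc (nth 0 la) i j.
Proof. by rewrite nth_incr_nth /inc addnC eq_sym. Qed.

Lemma is_part_incr la i : is_part la -> i <= size la ->
  is_part (incr_nth la i) = addable (nth 0 la) i.
Proof.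
move=> /is_partP[mono pos] ila; apply/is_partP/idP => [[mono' _]|ai].
  rewrite /addable; case: i ila mono' => //= i _ /(_ i).
  by rewrite !nth_incr /inc eqxx; lia.
split=> j; rewrite !nth_incr /inc.
  have := mono j; move: ai; rewrite /addable.
  by case: (i =P j.+1) => [->|] /=; lia.
rewrite size_incr_nth; have [ij _|ij] := eqVneq j i; first by rewrite addn1.
rewrite addn0; case: (ltnP i (size la)) => [_ /pos //|le].
have -> : i = size la by apply/eqP; rewrite eqn_leq ila.
rewrite ltnS leq_eqVlt => /predU1P[e|/pos //].
by move: ij ila le; rewrite e; lia.
Qed.

Lemma addable_size la i : is_part la -> addable (nth 0 la) i -> i <= size la.
Proof.
move=> _; rewrite /addable; case: i => //= i; rewrite ltnNge.
by case: ltnP => // le; rewrite [nth 0 la i]nth_default.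
Qed.

Lemma add_box_nth la mu i : is_part la -> is_part mu ->
  nth 0 mu =1 inc (nth 0 la) i -> mu = incr_nth la i /\ mu \in add_box la.
Proof.
move=> pla pmu e.
have ai : addable (nth 0 la) i.
  have /is_partP[/(_ i.-1) + _] := pmu; rewrite !e /addable /inc.
  by case: i {e} => //= i; lia.
have ila := addable_size pla ai.
have <- : mu = incr_nth la i.
  by apply: part_nth_inj; rewrite ?is_part_incr // => j; rewrite e nth_incr.
split=> //; rewrite mem_filter pmu andTb; apply/mapP; exists i.
  by rewrite mem_iota.
by apply: part_nth_inj; rewrite ?is_part_incr // => j; rewrite e nth_incr.
Qed.

Lemma sumn_incr_nth la i : sumn (incr_nth la i) = (sumn la).+1.
Proof.
elim: la i => [|m la IH] [|i] //=; last by rewrite IH addnS.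
by elim: i.
Qed.

Lemma sumn_add_box la mu : is_part la -> mu \in add_box la -> sumn mu = (sumn la).+1.
Proof.
by move=> pla /(mem_add_box pla)[_ [i ->]]; rewrite sumn_incr_nth.
Qed.

Lemma incr_nth_inj la : injective (incr_nth la).
Proof.
move=> i j e; have := nth_incr la i i; rewrite e nth_incr /inc eqxx.
by case: eqP => //; lia.
Qed.

Lemma add_box_uniq la : uniq (add_box la).
Proof.
by apply: filter_uniq; rewrite map_inj_uniq ?iota_uniq //; apply: incr_nth_inj.
Qed.

Lemma big_add_box la N (G : seq nat -> nat) : is_part la -> size la <= N ->
  \sum_(mu <- add_box la) G mu
    = \sum_(i < N.+1 | addable (nth 0 la) i) G (incr_nth la i).
Proof.
move=> pla laN; rewrite /add_box big_filter big_map.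
rewrite -[iota 0 _]/(index_iota 0 (size la).+1) big_mkord.
rewrite [LHS](big_ord_widen_cond N.+1 (fun i => is_part (incr_nth la i)) (fun i => G (incr_nth la i))) //.
apply: eq_bigl => i; rewrite ltnS.
have [ila|ila] := leqP i (size la); first by rewrite andbT is_part_incr.
by rewrite andbF; apply/esym; apply: contraTF ila => /(addable_size pla); rewrite -leqNgt.
Qed.

Fixpoint parts n : seq (seq nat) :=
  if n is n'.+1 then undup (flatten [seq add_box la | la <- parts n'])
  else [:: [::]].

Lemma parts_uniq n : uniq (parts n).
Proof. by case: n => [|n] //; apply: undup_uniq. Qed.

Lemma exists_remove mu j : is_part mu -> removable (nth 0 mu) j ->
  exists la, [/\ is_part la, nth 0 la =1 dec (nth 0 mu) j,
                 mu = incr_nth la j & mu \in add_box la].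
Proof.
move=> pmu rj; have /is_partP[mono pos] := pmu.
have [||la pla e] := @part_fun (dec (nth 0 mu) j) (size mu).
- move=> i; move: rj (mono i); rewrite /removable /dec.
  by case: (i =P j) => [->|]; lia.
- by rewrite /dec nth_default.
have e' : nth 0 mu =1 inc (nth 0 la) j.
  move=> i; rewrite /inc e /dec subnK //; case: eqP => [->|//].
  exact: leq_ltn_trans rj.
by have [] := add_box_nth pla pmu e'; exists la.
Qed.

Lemma mem_parts n mu : (mu \in parts n) = part_of n mu.
Proof.
rewrite /part_of; elim: n mu => [|n IH] mu.
  rewrite inE; apply/eqP/andP => [->|[pmu /eqP s0]] //.
  by apply/nilP; rewrite /nilp -leqn0 -s0 size_part.
rewrite mem_undup; apply/flatten_mapP/andP => [[la]|[pmu /eqP smu]].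
  rewrite IH => /andP[pla /eqP sla] mula.
  by rewrite (sumn_add_box pla) // sla (mem_add_box pla mula).1.
have mu0 : 0 < size mu by case: mu smu {pmu}.
have /is_partP[_ /(_ (size mu).-1)] := pmu.
rewrite prednK // leqnn => /(_ isT) pos.
have rj : removable (nth 0 mu) (size mu).-1.
  by rewrite /removable prednK // nth_default.
have [la [pla _ _ mula]] := exists_remove pmu rj.
exists la => //; rewrite IH pla /=.
by have := sumn_add_box pla mula; rewrite smu => -[->].
Qed.

Arguments parts : simpl never.

(** The free bound [N] lets shapes of different sizes share one bound on the number of rows. *)
Definition nsyt N la := syt N (sumn la) (nth 0 la).

(** Once dimensions are known to count standard tableaux, this says that the transition
    probabilities out of [la] add up to 1. *)
Lemma nsyt_up N la : is_part la -> sumn la <= N ->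
  \sum_(mu <- add_box la) nsyt N.+1 mu = (sumn la).+1 * nsyt N.+1 la.
Proof.
move=> pla laN; have sN : size la <= N by apply: leq_trans laN; apply: size_part.
rewrite (big_add_box _ pla sN) -sum_syt_addable //.
- by apply: eq_bigr => i _; rewrite /nsyt sumn_incr_nth; apply/eq_syt/nth_incr.
- by have /is_partP[] := pla.
- by rewrite nth_default.
- by rewrite sum_nth // leqW.
Qed.

Lemma nsyt_down N n mu : part_of n.+1 mu -> n < N ->
  nsyt N mu = \sum_(la <- parts n | mu \in add_box la) nsyt N la.
Proof.
move=> /andP[pmu /eqP smu] nN; have /is_partP[mono pos] := pmu.
have sN : size mu <= N by rewrite (leq_trans (size_part pmu)) ?smu.
transitivity (\sum_(la <- parts n)
    \sum_(j < N | removable (nth 0 mu) j && (incr_nth la j == mu)) nsyt N la).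
  rewrite (exchange_big_dep (fun j : 'I_N => removable (nth 0 mu) j)) /=; last by move=> la j _ /andP[].
  rewrite /nsyt smu sytS; apply: eq_bigr => j rj.
  have [la [pla e mue mula]] := exists_remove pmu rj.
  have sla : sumn la = n by have := sumn_add_box pla mula; rewrite smu => -[].
  have lap : la \in parts n by rewrite mem_parts /part_of pla sla eqxx.
  rewrite [RHS]big_mkcond (bigD1_seq la) ?parts_uniq //= [X in _ + X]big1_seq ?addn0.
    by rewrite rj -mue eqxx sla; apply: eq_syt => i; rewrite e.
  move=> la' /andP[la'la]; rewrite mem_parts => /andP[pla' _].
  case: eqP => [mue'|]; last by rewrite andbF.
  case/eqP: la'la; apply: part_nth_inj => // i; rewrite e -mue' /dec nth_incr /inc.
  by rewrite addnK.
rewrite [RHS]big_mkcond; apply: eq_big_seq => la; rewrite mem_parts => /andP[pla _].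
case: ifP => [/(mem_add_box pla)[_ [i mue]]|nla].
  have emu k : nth 0 mu k = inc (nth 0 la) i k by rewrite mue nth_incr.
  have iN : i < N.
    apply: leq_trans sN; rewrite ltnNge; apply/negP => /(nth_default 0).
    by rewrite emu /inc eqxx addn1.
  rewrite (big_pred1 (Ordinal iN)) // => k /=.
  apply/andP/eqP => [[_ /eqP]|->].
    by rewrite mue => /incr_nth_inj ki; apply: val_inj.
  split; last exact/eqP.
  rewrite /removable !emu /inc /= eqxx; have /is_partP[/(_ i) + _] := pla.
  by lia.
rewrite big1 // => j /andP[_ /eqP mue].
have e k : nth 0 mu k = inc (nth 0 la) j k by rewrite -mue nth_incr.
by have [_] := add_box_nth pla pmu e; rewrite nla.
Qed.

(** One factor of each square is expanded downwards, the sums are exchanged, and the other factor is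
    summed upwards, which yields the factor [n.+1] at each level. *)
Lemma sum_sqr_nsyt N n : n <= N -> \sum_(la <- parts n) nsyt N.+1 la ^ 2 = n`!.
Proof.
elim: n => [|n IH] nN; first by rewrite big_seq1.
rewrite factS -IH ?(ltnW nN) // big_distrr /=.
transitivity (\sum_(mu <- parts n.+1) \sum_(la <- parts n | mu \in add_box la)
    nsyt N.+1 mu * nsyt N.+1 la).
  apply: eq_big_seq => mu; rewrite mem_parts => pmu.
  by rewrite -mulnn {2}(@nsyt_down N.+1 n mu pmu (ltnW nN)) big_distrr.
rewrite (exchange_big_dep predT) //=; apply: eq_big_seq => la.
rewrite mem_parts => /andP[pla /eqP sla]; rewrite -big_distrl /= -mulnn mulnA.
congr (_ * _); rewrite -[in RHS]sla -nsyt_up ?sla 1?ltnW // -big_filter.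
apply/perm_big/uniq_perm; rewrite ?add_box_uniq ?filter_uniq ?parts_uniq // => mu.
rewrite mem_filter mem_parts; apply: andb_idr => mula.
by rewrite /part_of (mem_add_box pla mula).1 (sumn_add_box pla mula) sla eqxx.
Qed.

(** A box fits both at the end of the first row and in a new row; this is what keeps [vartheta]
    below 1. *)
Lemma add_box_two la mu : is_part la -> la != [::] -> mu \in add_box la ->
  exists2 nu, nu \in add_box la & nu != mu.
Proof.
move=> pla la0 mula.
have add i : i <= size la -> addable (nth 0 la) i -> incr_nth la i \in add_box la.
  move=> ila ai; have p : is_part (incr_nth la i) by rewrite is_part_incr.
  by have [] := add_box_nth pla p (nth_incr la i).
have m0 := add 0 isT isT.
have ms : incr_nth la (size la) \in add_box la.
  apply: add => //; rewrite /addable nth_default //.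
  case: la la0 pla {m0 mula} => //= a l _.
  by move=> /is_partP[_ /(_ (size l))]; apply.
have [e|ne] := eqVneq (incr_nth la 0) mu; last by exists (incr_nth la 0).
exists (incr_nth la (size la)) => //; rewrite -e.
by rewrite (inj_eq (@incr_nth_inj la)); case: la la0 {pla m0 ms mula e add}.
Qed.

End Partitions.

(** * Branching *)

(** Used twice in the branching argument, to turn a comparison of totals into termwise
    equalities. *)
Lemma big_eq_lower (R : numDomainType) (I : eqType) (s : seq I) (a b : I -> R) :
  {in s, forall i, a i <= b i} -> \sum_(i <- s) b i <= \sum_(i <- s) a i ->
  {in s, forall i, b i = a i}.
Proof.
elim: s => //= i s IH ab; rewrite !big_cons => le.
have abi : a i <= b i by apply: ab; rewrite mem_head.
have abs : {in s, forall j, a j <= b j}.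
  by move=> j js; apply: ab; rewrite inE js orbT.
have les : \sum_(j <- s) a j <= \sum_(j <- s) b j.
  by rewrite !big_seq; apply: ler_sum.
have bai : b i <= a i.
  by rewrite -(lerD2r (\sum_(j <- s) a j)) (le_trans _ le) // lerD2l.
move=> j; rewrite inE => /predU1P[->|]; first by apply/le_anti/andP.
apply: IH => //.
by rewrite -(lerD2l (a i)) (le_trans _ le) // lerD2r.
Qed.

Lemma mxrank_mxsub (F : fieldType) m n m' n' (f : 'I_m' -> 'I_m)
    (g : 'I_n' -> 'I_n) (M : 'M[F]_(m, n)) : (\rank (mxsub f g M) <= \rank M)%N.
Proof.
have -> : mxsub f g M = rowsub f 1%:M *m M *m colsub g 1%:M.
  rewrite mulmx_colsub mulmx1 mul_rowsub_mx mul1mx; apply/matrixP=> i j.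
  by rewrite !mxE.
by rewrite (leq_trans (mxrankM_maxl _ _)) // mxrankM_maxr.
Qed.

Definition tab_of (T : finType) (X : {set T}) (la : seq nat) (x : T) :=
  (tab_row X la x, tab_col X la x).

Lemma tab_ofP (T : finType) (X : {set T}) la :
  sumn la = #|X| -> is_tab X la (tab_of X la).
Proof.
move=> sla; have lt x : x \in X -> (index x (enum X) < sumn la)%N.
  by move=> xX; rewrite sla cardE index_mem mem_enum.
apply: is_tabI => // [x y xX yX [] rxy cxy|x xX]; last exact: reshape_offsetP (lt x xX).
have : index x (enum X) = index y (enum X).
  rewrite -(reshape_indexK la (index x _)) -(reshape_indexK la (index y _)).
  by congr flatten_index.
by apply: index_inj; rewrite ?mem_enum.
Qed.

Section Branching.

Variables (F : numFieldType) (T : finType).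
Local Notation A := (galg F {perm T}).
Local Notation de := (gdelta F).
Implicit Types (X Z : {set T}) (la mu : seq nat).

Definition alpha X la : A := ychar F X (tab_of X la).
Definition fdim X la : nat := ydim F X (tab_of X la).
Definition eproj X la : A := ((fdim X la)%:R / (#|X|`!)%:R) *: alpha X la.

Lemma fdim_gt0 X la : sumn la = #|X| -> (0 < fdim X la)%N.
Proof. by move=> /tab_ofP; apply: ydim_gt0. Qed.

Lemma gtau_alpha X la : sumn la = #|X| -> gtau (alpha X la) = (fdim X la)%:R.
Proof. by move=> /tab_ofP; apply: gtau_ychar. Qed.

Lemma alpha_supp X la : alpha X la \in gsupp (Sym_group X).
Proof. exact: ychar_supp. Qed.

Lemma eproj_supp X la : eproj X la \in gsupp (Sym_group X).
Proof. exact/gsuppZ/alpha_supp. Qed.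

Lemma Sym_sub X Z : X \subset Z -> Sym X \subset Sym Z.
Proof.
move=> XZ; apply/subsetP=> g; rewrite !inE => gX.
exact: subset_trans gX XZ.
Qed.

Lemma gsupp_sub X Z (x : A) : X \subset Z ->
  x \in gsupp (Sym_group X) -> x \in gsupp (Sym_group Z).
Proof.
move=> XZ /gsuppP xX; apply/gsuppP=> g gZ; apply: xX; apply: contra gZ.
exact/subsetP/Sym_sub.
Qed.

Lemma fact_neq0 n : n`!%:R != 0 :> F.
Proof. by rewrite pnatr_eq0 -lt0n fact_gt0. Qed.

Lemma alpha_eproj X la : sumn la = #|X| ->
  alpha X la = ((#|X|`!)%:R / (fdim X la)%:R) *: eproj X la.
Proof.
move=> sla; have f0 : (fdim X la)%:R != 0 :> F by rewrite pnatr_eq0 -lt0n fdim_gt0.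
by rewrite /eproj scalerA mulrA mulfVK // mulfV ?scale1r // fact_neq0.
Qed.

Lemma alpha_sqr X la : sumn la = #|X| ->
  alpha X la * alpha X la = ((#|X|`!)%:R / (fdim X la)%:R) *: alpha X la.
Proof.
by move=> /tab_ofP tD; rewrite /alpha (ychar_sqr _ tD) (hookE _ tD).
Qed.

Lemma eproj_sqr X la : sumn la = #|X| -> eproj X la * eproj X la = eproj X la.
Proof.
move=> sla; have f0 : (fdim X la)%:R != 0 :> F by rewrite pnatr_eq0 -lt0n fdim_gt0.
rewrite /eproj; move: (alpha X la) (alpha_sqr sla) => a aa.
rewrite -scalerAr -scalerAl aa !scalerA; congr (_ *: _).
by rewrite -mulrA [X in _ * X]mulrA mulfVK ?fact_neq0 // mulfV ?mulr1.
Qed.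

Lemma alpha_orth X la mu : part_of #|X| la -> part_of #|X| mu -> la != mu ->
  alpha X la * alpha X mu = 0.
Proof.
move=> /andP[pla /eqP sla] /andP[pmu /eqP smu] /eqP ne.
exact: ychar_orth pla pmu ne (tab_ofP sla) (tab_ofP smu).
Qed.

Lemma alpha_conj X la (s : {perm T}) : sumn la = #|X| ->
  de s^-1 * alpha X la * de s = alpha (s @: X) la.
Proof.
move=> sla; pose t x := tab_of X la (s^-1 x)%g.
have ts : {in X, forall x, t (s x) = tab_of X la x} by move=> x _; rewrite /t permK.
rewrite -(ychar_move _ ts); apply: (@ychar_uniq _ _ _ la); last first.
  by apply: tab_ofP; rewrite card_imset //; apply: perm_inj.
have tD := tab_ofP sla; apply: is_tabI => [x y||].
- by move=> /imsetP[x' xX ->] /imsetP[y' yX ->]; rewrite !ts // => /(tab_inj tD)->.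
- by move=> _ /imsetP[x xX ->]; rewrite !ts //; apply: tab_mem tD xX.
by rewrite card_imset //; apply: perm_inj.
Qed.

Lemma alpha_comm X la x : x \in gsupp (Sym_group X) ->
  x * alpha X la = alpha X la * x.
Proof. exact: ychar_comm. Qed.

Lemma eproj_comm X la x : x \in gsupp (Sym_group X) ->
  x * eproj X la = eproj X la * x.
Proof. by move=> xX; rewrite /eproj -scalerAr -scalerAl alpha_comm. Qed.

Lemma eproj_sum_idem X (u := \sum_(la <- parts #|X|) eproj X la) :
  (1 - u) * (1 - u) = 1 - u.
Proof.
have uu : u * u = u.
  rewrite {1}/u mulr_suml; apply: eq_big_seq => la laP; rewrite mulr_sumr.
  have /andP[pla /eqP sla] : part_of #|X| la by rewrite -mem_parts.
  rewrite (bigD1_seq la) ?parts_uniq //= eproj_sqr // big1_seq ?addr0 // => mu.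
  case/andP=> mula muP; rewrite -scalerAr -scalerAl alpha_orth -?mem_parts ?scaler0 //.
  by rewrite eq_sym.
by rewrite mulrBl mul1r mulrBr mulr1 uu subrr subr0.
Qed.

(** The trace of the idempotent complementary to all the [eproj] is the defect in [sum f^2 = #|X|!];
    its sign gives the inequality and its vanishing gives completeness. *)
Lemma sum_sqr_fdim X :
  gtau (1 - \sum_(la <- parts #|X|) eproj X la) * (#|X|`!)%:R
    = (#|X|`!)%:R - \sum_(la <- parts #|X|) (fdim X la)%:R ^+ 2.
Proof.
rewrite gtauD -scaleN1r gtauZ mulN1r gtau_sum mulrBl.
rewrite {1}/gtau -gdelta1 ffunE eqxx mul1r mulr_suml; congr (_ - _).
apply: eq_big_seq => la; rewrite mem_parts => /andP[_ /eqP sla].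
by rewrite gtauZ gtau_alpha // mulrAC mulfVK ?expr2 ?fact_neq0.
Qed.

Lemma gopmx_tr_supp X (u : A) : \tr (gopmx (Sym_group X) u 1) = gtau u * (#|X|`!)%:R.
Proof.
rewrite gopmx_tr mulr1 gtau_sum.
under eq_bigr => g _ do rewrite gtau_mulC mulrA -gdeltaM mulgV gdelta1 mul1r.
by rewrite sumr_const card_Sym mulr_natr.
Qed.

Lemma eproj_sum_supp X :
  1 - \sum_(la <- parts #|X|) eproj X la \in gsupp (Sym_group X).
Proof. by rewrite rpredB ?rpred1 ?rpred_sum // => la _; apply: eproj_supp. Qed.

Lemma sum_sqr_fdim_le X :
  \sum_(la <- parts #|X|) (fdim X la)%:R ^+ 2 <= (#|X|`!)%:R :> F.
Proof.
rewrite -subr_ge0 -sum_sqr_fdim -gopmx_tr_supp (mxtrace_quasi_idem (h := 1)).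
  by rewrite mul1r ler0n.
by rewrite gopmxM ?eproj_sum_supp ?rpred1 // eproj_sum_idem mulr1 scale1r.
Qed.

(* A projection of trace zero vanishes. *)
Lemma eproj_sum1 X :
  \sum_(la <- parts #|X|) (fdim X la)%:R ^+ 2 = (#|X|`!)%:R :> F ->
  \sum_(la <- parts #|X|) eproj X la = 1.
Proof.
move=> e; apply/esym/eqP; rewrite -subr_eq0; apply/eqP.
apply: (gopmx_eq0 (eproj_sum_supp X)); apply: (quasi_idem_eq0 (h := 1)).
- by rewrite gopmxM ?eproj_sum_supp ?rpred1 // eproj_sum_idem mulr1 scale1r.
- by rewrite gopmx_tr_supp sum_sqr_fdim e subrr.
- exact: oner_neq0.
Qed.

(** The left side is the character of [mu] at [eproj X la], that is, [f^la] times a branching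
    multiplicity. It is a rank because [x |-> c x e], with [c] the symmetrizer and [e] the
    idempotent, is quasi-idempotent. *)
Lemma gtau_alpha_eproj X Z la mu t : X \subset Z -> sumn la = #|X| ->
  is_tab Z mu t ->
  gtau (ychar F Z t * eproj X la) = (\rank (gopmx (Sym_group Z) (young F Z t) (eproj X la)))%:R.
Proof.
move=> XZ sla tD; apply: (mulfI (hook_neq0 F tD)).
have eZ : eproj X la \in gsupp (Sym_group Z).
  exact: gsupp_sub XZ (eproj_supp X la).
rewrite -mxtrace_quasi_idem; last first.
  by rewrite gopmxM ?young_supp // (young_sqr _ tD) eproj_sqr // gopmxZ.
by rewrite gopmx_tr -gtauZ scalerAl scalerA mulfV ?(hook_neq0 F tD) // scale1r.
Qed.

Lemma gtau_alpha_eproj_ge0 X Z la mu : X \subset Z -> sumn la = #|X| ->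
  sumn mu = #|Z| -> 0 <= gtau (alpha Z mu * eproj X la).
Proof.
by move=> XZ sla smu; rewrite (gtau_alpha_eproj XZ sla (tab_ofP smu)) ler0n.
Qed.

Lemma stab_setU1 X z (r r' : T -> nat) h : z \notin X ->
  {in X, r =1 r'} -> h \in Sym X -> (h \in stab (z |: X) r) = (h \in stab X r').
Proof.
move=> zX rr' hX; have hz : h z = z by move: hX; rewrite inE => /out_perm->.
apply/stabP/stabP=> -[hS hr]; split=> //.
- by move=> x xX; rewrite -!rr' ?Sym_closed // hr // setU1r.
- exact: (subsetP (Sym_sub (subsetUr _ _))).
move=> x /setU1P[->|xX]; first by rewrite hz.
by rewrite !rr' ?Sym_closed // hr.
Qed.

Section AddBox.

Variables (X : {set T}) (z : T) (la : seq nat) (i : nat).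
Hypotheses (zX : z \notin X) (pla : is_part la) (sla : sumn la = #|X|).

Let t x := if x == z then (i, nth 0%N la i) else tab_of X la x.
Local Notation Z := (z |: X).
Local Notation mu := (incr_nth la i).

Let tX x : x \in X -> t x = tab_of X la x.
Proof. by rewrite /t; case: eqP => // -> zX'; rewrite (negPf zX) in zX'. Qed.

Let tz : t z = (i, nth 0%N la i). Proof. by rewrite /t eqxx. Qed.

Let tD : is_tab Z mu t.
Proof.
have tD := tab_ofP sla.
have zno x : x \in X -> t x <> t z.
  by move=> xX; rewrite tz tX // => e; have := tab_mem tD xX; rewrite e ltnn.
apply: is_tabI => [x y /setU1P[->|xX] /setU1P[->|yX] //|x /setU1P[->|xX]|].
- by move/esym/zno => /(_ yX).
- by move/zno => /(_ xX).
- by rewrite !tX //; apply: (tab_inj tD).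
- by rewrite tz nth_incr /inc eqxx addn1.
- rewrite tX // nth_incr /inc; apply: leq_trans (tab_mem tD xX) _.
  exact: leq_addr.
by rewrite cardsU1 zX sumn_incr_nth sla.
Qed.

(** If [g] fixes [z] and is a row permutation [h] followed by a column permutation, then [h z] lies
    in the row and in the column of [z], so [h] fixes [z]: the larger tableau gives no new
    factorizations. *)
Lemma young_restr g : g \in Sym X ->
  young F Z t g = young F X (tab_of X la) g.
Proof.
move=> gX; rewrite !youngE; apply: eq_bigr => h _.
have rX : {in X, row_of t =1 row_of (tab_of X la)} by move=> x xX; rewrite /row_of tX.
have cX : {in X, col_of t =1 col_of (tab_of X la)} by move=> x xX; rewrite /col_of tX.
have [hX|hX] := boolP (h \in Sym X).
  by rewrite (stab_setU1 zX rX) // (stab_setU1 zX cX) // groupM ?groupV.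
rewrite [in RHS](_ : h \in stab X _ = false) ?mul0r; last first.
  by apply: contraNF hX; apply: stab_Sym.
rewrite -natrM mulnb.
suff /negPf-> : ~~ ((h \in stab Z (row_of t)) && ((h^-1 * g)%g \in stab Z (col_of t))).
  by rewrite mul0r.
apply: contra hX => /andP[/stabP[hZ hr] /stabP[_ hc]].
have zZ : z \in Z by rewrite setU11.
have hzZ : h z \in Z by rewrite (Sym_closed _ hZ).
have hz : h z = z.
  apply: (tab_inj tD) => //; rewrite [LHS]surjective_pairing [RHS]surjective_pairing.
  congr pair; first exact: hr.
  have := hc _ hzZ; rewrite permM permK => e; apply: etrans (esym e) _.
  by move: gX; rewrite inE /col_of => /out_perm->.
move: hZ; rewrite !inE => /subsetP sub; apply/subsetP=> x hx.
by have /setU1P[xz|//] := sub x hx; rewrite inE xz hz eqxx in hx.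
Qed.

(* Restricting coefficients to [Sym X] maps the right ideal of the Young
   symmetrizer of [mu] onto an ideal containing that of [la]. *)
Lemma gtau_alpha_eproj_ge : (fdim X la)%:R <= gtau (alpha Z mu * eproj X la).
Proof.
rewrite /alpha (ychar_uniq F (tab_ofP _) tD); last by rewrite -(tab_card tD).
rewrite (gtau_alpha_eproj (subsetUr _ _) sla tD) ler_nat /fdim /ydim.
have XZ : Sym X \subset Sym Z by apply/Sym_sub/subsetUr.
pose f (k : 'I_#|Sym_group X|) := enum_rank_in (group1 (Sym_group Z)) (enum_val k).
have fK k : enum_val (f k) = enum_val k.
  by rewrite enum_rankK_in //; apply: (subsetP XZ); apply: enum_valP.
suff -> : gopmx (Sym_group X) (young F X (tab_of X la)) 1 =
    mxsub f f (gopmx (Sym_group Z) (young F Z t) (eproj X la)).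
  exact: mxrank_mxsub.
apply/matrixP=> j k; rewrite !mxE !fK mulr1.
set x := enum_val j; set y := enum_val k.
have xX : x \in Sym X := enum_valP j; have yX : y \in Sym X := enum_valP k.
have eX := eproj_supp X la.
rewrite -[in RHS]mulrA (eproj_comm _ (gsupp_delta F xX)) [in RHS]mulrA.
rewrite !galg_mul_deltaE.
set w := (y * _)%g; have wX : w \in Sym X by rewrite groupM ?groupV.
(* The symmetrizer of [la] absorbs the idempotent [eproj X la], so this factor may be inserted on
   the smaller side. *)
have <- : young F X (tab_of X la) * eproj X la = young F X (tab_of X la).
  rewrite /eproj -scalerAr (young_ychar _ (tab_ofP sla)) (hookE _ (tab_ofP sla)) scalerA.
  have f0 : (fdim X la)%:R != 0 :> F by rewrite pnatr_eq0 -lt0n fdim_gt0.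
  by rewrite mulrA mulfVK ?fact_neq0 // mulfV ?scale1r.
rewrite !galgME; apply: eq_bigr => g _.
have [gX|gX] := boolP (g \in Sym X); first by rewrite young_restr.
have /gsuppP -> := eX; rewrite ?mulr0 //.
by rewrite groupMr // groupV.
Qed.

End AddBox.

(** * Completeness and multiplicity one *)

Definition complete X := \sum_(la <- parts #|X|) eproj X la = 1.

Lemma gtau_complete X Z mu : X \subset Z -> sumn mu = #|Z| -> complete X ->
  (fdim Z mu)%:R = \sum_(la <- parts #|X|) gtau (alpha Z mu * eproj X la).
Proof.
move=> XZ smu cX; rewrite -gtau_alpha // -[alpha Z mu]mulr1 -{1}cX mulr_sumr.
by rewrite gtau_sum; apply: eq_bigr => la _; rewrite mulr1.
Qed.

Lemma gtau_alpha_eproj_lower X z la mu : z \notin X ->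
  part_of #|X| la -> part_of #|X|.+1 mu ->
  (if mu \in add_box la then (fdim X la)%:R else 0)
    <= gtau (alpha (z |: X) mu * eproj X la).
Proof.
move=> zX /andP[pla /eqP sla] /andP[pmu /eqP smu]; case: ifP => [mula|_].
  have [_ [i ->]] := mem_add_box pla mula.
  exact: gtau_alpha_eproj_ge.
by apply: gtau_alpha_eproj_ge0 => //; rewrite ?subsetUr ?cardsU1 ?zX.
Qed.

(* Branching gives [nsyt <= fdim]; since [sum fdim^2 <= n! = sum nsyt^2], equality
   holds throughout and the projections [eproj] sum to the identity. *)
Lemma fdim_nsyt X N : (#|X| <= N)%N ->
  complete X /\ {in parts #|X|, forall la, fdim X la = nsyt N.+1 la}.
Proof.
elim: {X}_.+1 {-2}X (ltnSn #|X|) => // n IH Z; rewrite ltnS => Zn ZN.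
have lower : {in parts #|Z|, forall mu, (nsyt N.+1 mu <= fdim Z mu)%N}.
  have [->|[z zZ]] := set_0Vmem Z.
    rewrite cards0 => mu; rewrite inE => /eqP->.
    by apply: fdim_gt0; rewrite cards0.
  have [X zX defZ] : exists2 X : {set T}, z \notin X & Z = z |: X.
    by exists (Z :\ z); rewrite ?setD1K // !inE eqxx.
  rewrite {Z zZ}defZ in Zn ZN *.
  have cZ : #|z |: X| = #|X|.+1 by rewrite cardsU1 zX.
  have [||cX fX] := IH X; [by rewrite -ltnS -cZ | by rewrite ltnW // -cZ |].
  move=> mu; rewrite cZ mem_parts => muP; have /andP[_ /eqP smu] := muP.
  rewrite -(ler_nat F) (gtau_complete (X := X)) ?subsetUr ?cZ //.
  rewrite (@nsyt_down _ #|X|) //; last by rewrite -cZ leqW.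
  rewrite big_mkcond natr_sum !big_seq; apply: ler_sum => la laP.
  apply: le_trans (gtau_alpha_eproj_lower zX _ muP); last by rewrite -mem_parts.
  by case: ifP => _ //; rewrite fX.
have eqf : {in parts #|Z|, forall mu, (fdim Z mu)%:R ^+ 2 = (nsyt N.+1 mu)%:R ^+ 2 :> F}.
  apply: big_eq_lower => [mu muP|].
    by rewrite -!natrX ler_nat leq_sqr lower.
  apply: le_trans (sum_sqr_fdim_le Z) _; rewrite -(sum_sqr_nsyt ZN) natr_sum.
  by rewrite le_eqVlt (eq_bigr (fun mu => (nsyt N.+1 mu)%:R ^+ 2)) ?eqxx // => mu _; rewrite natrX.
split=> [|mu muP].
  apply: eproj_sum1; rewrite (eq_big_seq _ eqf) -(sum_sqr_nsyt ZN) natr_sum.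
  by apply: eq_bigr => mu _; rewrite natrX.
by apply/eqP; rewrite -eqn_sqr -(eqr_nat F) !natrX eqf.
Qed.

Lemma completeT X : complete X.
Proof. by have [] := fdim_nsyt (leqnn #|X|). Qed.

(** Multiplicity one: the lower bounds already add up to [f^mu], by the recursion for standard
    tableaux, so none of them is strict. *)
Lemma gtau_alpha_eprojE X z la mu : z \notin X ->
  part_of #|X| la -> part_of #|X|.+1 mu ->
  gtau (alpha (z |: X) mu * eproj X la)
    = if mu \in add_box la then (fdim X la)%:R else 0.
Proof.
move=> zX laP muP; rewrite -mem_parts in laP; set N := #|z |: X|.
have cZ : #|z |: X| = #|X|.+1 by rewrite cardsU1 zX.
have XN : (#|X| <= N)%N by rewrite /N cZ.
move: la laP; apply: big_eq_lower => [la laP|].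
  by apply: gtau_alpha_eproj_lower; rewrite // -mem_parts.
have /andP[_ /eqP smu] := muP.
apply: (le_trans (y := (fdim (z |: X) mu)%:R)).
  by rewrite (gtau_complete (X := X)) ?subsetUr ?cZ //; apply: completeT.
have [_ ->] := fdim_nsyt (leqnn #|z |: X|); last by rewrite mem_parts cZ.
rewrite (@nsyt_down _ #|X|) //.
rewrite big_mkcond natr_sum !big_seq; apply: ler_sum => la laP.
by have [_ fX] := fdim_nsyt XN; rewrite fX //; case: ifP.
Qed.

Lemma sum_alpha_conj Z la n (s : {perm T}) (C := \sum_(j in Z) alpha (Z :\ j) la) :
  s \in Sym Z -> #|Z| = n.+1 -> sumn la = n -> de s^-1 * C * de s = C.
Proof.
move=> sZ cZ sla; rewrite /C mulr_sumr mulr_suml.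
rewrite [RHS](reindex_inj (@perm_inj _ s)) /=.
apply: eq_big => [j|j jZ]; first by rewrite Sym_closed.
rewrite alpha_conj; last by rewrite sla; move: cZ; rewrite (cardsD1 j) jZ => -[].
congr alpha; apply/setP=> x; rewrite -(permKV s x) mem_imset; last exact: perm_inj.
by rewrite !inE (inj_eq perm_inj) (Sym_closed _ sZ).
Qed.

(** The sum [C] commutes with [Sym Z], hence multiplies each [alpha Z mu] by a scalar. Traces
    determine it: each of the [n + 1] terms contributes [n!] if [mu] covers [la] and nothing
    otherwise. *)
Lemma sum_alpha_branch Z la n : #|Z| = n.+1 -> part_of n la ->
  \sum_(j in Z) alpha (Z :\ j) la = \sum_(mu <- add_box la) alpha Z mu.
Proof.
move=> cZ laP; have /andP[pla /eqP sla] := laP.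
set C := \sum_(j in Z) _.
have CJ s (sZ : s \in Sym Z) : de s^-1 * C * de s = C by apply: sum_alpha_conj cZ sla.
have Cde s : s \in Sym Z -> C * de s = de s * C.
  by move=> sZ; rewrite -{2}(CJ s sZ) !mulrA -gdeltaM mulgV gdelta1 mul1r.
have CZ : C \in gsupp (Sym_group Z).
  by apply: rpred_sum => j jZ; apply: gsupp_sub (subsetDl _ _) (alpha_supp _ _).
have Cmu mu : part_of n.+1 mu -> C * eproj Z mu = if mu \in add_box la then alpha Z mu else 0.
  move=> muP; have /andP[pmu /eqP smu] := muP.
  have smuZ : sumn mu = #|Z| by rewrite smu.
  have tD := tab_ofP smuZ.
  have [l Cl] : exists l, C * alpha Z mu = l *: alpha Z mu.
    set y := young F Z (tab_of Z mu).
    have [l Cy] : exists l, C * y = l *: y.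
      (* From [y C y = C y y = h C y] and the sandwich property. *)
      exists ((hook F Z (tab_of Z mu))^-1 * gtau (y * C * y)).
      rewrite -scalerA -(young_sandwich tD CZ) -/y.
      rewrite (gsupp_comm (young_supp F Z (tab_of Z mu)) (y := C)); last first.
        by move=> g gZ; rewrite Cde.
      rewrite -mulrA (young_sqr _ tD) -/y -scalerAr scalerA mulVf ?scale1r //.
      exact: hook_neq0 tD.
    exists l; rewrite ychar_mull // -/y Cy scalerA mulrC -scalerA; congr (_ *: _).
    by rewrite scaler_sumr; apply: eq_bigr => g _; rewrite -scalerAr -scalerAl.
  have f0 : (fdim Z mu)%:R != 0 :> F by rewrite pnatr_eq0 -lt0n fdim_gt0.
  have lE : l * (fdim Z mu)%:R = if mu \in add_box la then (#|Z|`!)%:R else 0.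
    rewrite -gtau_alpha // -gtauZ -Cl mulr_suml gtau_sum.
    rewrite (eq_bigr (fun=> if mu \in add_box la then (n`!)%:R else 0)).
      by rewrite sumr_const cZ factS; case: ifP; rewrite ?mul0rn // mulnC natrM mulr_natr.
    move=> j jZ; have cj : #|Z :\ j| = n by move: cZ; rewrite (cardsD1 j) jZ => -[].
    have jj : j \notin Z :\ j by rewrite !inE eqxx.
    rewrite gtau_mulC (alpha_eproj (X := Z :\ j)) ?cj // -scalerAr gtauZ.
    have := @gtau_alpha_eprojE (Z :\ j) j la mu jj.
    rewrite cj setD1K // => -> //; case: ifP => _; last by rewrite mulr0.
    by rewrite mulfVK // pnatr_eq0 -lt0n fdim_gt0 ?cj.
  rewrite /eproj -scalerAr Cl scalerA mulrC mulrA lE.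
  by case: ifP => _; rewrite ?mul0r ?scale0r // mulfV ?scale1r ?fact_neq0.
rewrite -[LHS]mulr1 -(completeT Z) cZ mulr_sumr.
rewrite (eq_big_seq (fun mu => if mu \in add_box la then alpha Z mu else 0)).
  rewrite -big_mkcond -big_filter; apply/perm_big/uniq_perm.
  - by rewrite filter_uniq ?parts_uniq.
  - exact: add_box_uniq.
  move=> mu; rewrite mem_filter mem_parts; apply: andb_idr => mula.
  by rewrite /part_of (mem_add_box pla mula).1 (sumn_add_box pla mula) sla eqxx.
by move=> mu; rewrite mem_parts; apply: Cmu.
Qed.

End Branching.

(** * Specht modules *)

Section RightIdeal.

Variables (F : fieldType) (gT : finGroupType) (G : {group gT}).
Local Notation A := (galg F gT).
Local Notation aG := (regular_repr F G).

Lemma regular_gopmx g : g \in G -> aG g = gopmx G 1 (gdelta F g).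
Proof.
move=> gG; apply/matrixP=> i j; rewrite !mxE mul1r -gdeltaM ffunE.
by rewrite -(inj_eq enum_val_inj) gring_indexK // groupM ?enum_valP.
Qed.

Lemma gopmx_sumr (u : A) I (r : seq I) (Q : pred I) (v : I -> A) :
  gopmx G u (\sum_(i <- r | Q i) v i) = \sum_(i <- r | Q i) gopmx G u (v i).
Proof.
apply/matrixP=> j k; rewrite summxE !mxE mulr_sumr galg_sumE.
by apply: eq_bigr => i _; rewrite mxE.
Qed.

Lemma gopmxZr (u : A) a (v : A) : gopmx G u (a *: v) = a *: gopmx G u v.
Proof. by apply/matrixP=> i j; rewrite !mxE -scalerAr galgZE. Qed.

Definition galg_row (x : A) : 'rV[F]_#|G| := \row_j x (enum_val j).

Lemma galg_row_gopmx x u v : x \in gsupp G ->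
  galg_row x *m gopmx G u v = galg_row (u * x * v).
Proof.
move=> xG; apply/rowP=> j; rewrite !mxE (gsupp_expand_mul _ _ xG).
rewrite galg_sumE [RHS]big_enum_val /=; apply: eq_bigr => k _.
by rewrite !mxE galgZE.
Qed.

Variables (c : A) (h : F).
Hypotheses (cG : c \in gsupp G) (cc : c * c = h *: c) (h0 : h != 0).

Local Notation U := (cyclic_mx aG (galg_row c)).
Let P := h^-1 *: gopmx G c 1.

Lemma cyclic_gopmx : (U :=: gopmx G c 1)%MS.
Proof.
have rowc : galg_row c = galg_row 1 *m gopmx G c 1.
  by rewrite galg_row_gopmx ?rpred1 // !mulr1.
apply/eqmxP/andP; split.
  apply: cyclic_mx_sub; last by rewrite rowc submxMl.
  apply/mxmoduleP=> g gG; rewrite regular_gopmx //.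
  rewrite gopmxM ?rpred1 // !mul1r -[gopmx _ _ _](_ : gopmx G 1 (gdelta F g) *m gopmx G c 1 = _).
    exact: submxMl.
  by rewrite gopmxM ?rpred1 ?gsupp_delta // !mulr1.
apply/row_subP=> i.
have -> : row i (gopmx G c 1) = galg_row c *m aG (enum_val i).
  rewrite regular_gopmx ?enum_valP // galg_row_gopmx // mul1r.
  by apply/rowP=> j; rewrite !mxE mulr1.
exact: mxmodule_trans (cyclic_mx_module _ _) (enum_valP _) (cyclic_mx_id _ _).
Qed.

(** [P] projects the regular module onto [U], so the trace on [U] is the trace of [P *m aG g] on the
    whole module, which [gopmx_tr] evaluates. *)
Lemma mxtrace_cyclic g : g \in G ->
  \tr (submod_repr (cyclic_mx_module aG (galg_row c)) g)
    = gtau (h^-1 *: (\sum_(k in G) gdelta F k^-1 * c * gdelta F k) * gdelta F g).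
Proof.
move=> gG; have PP : P *m P = P.
  rewrite /P -scalemxAl -scalemxAr gopmxM ?rpred1 // cc gopmxZ mulr1.
  by rewrite [h^-1 *: (h *: _)]scalerA mulVf // scale1r.
have eP : (U :=: P)%MS.
  apply: eqmx_trans cyclic_gopmx (eqmx_sym _).
  by apply: eqmx_scale; rewrite invr_eq0.
rewrite -scalerAl gtauZ -gopmx_tr -mxtraceZ.
have -> : h^-1 *: gopmx G c (gdelta F g) = P *m aG g.
  by rewrite regular_gopmx // /P -scalemxAl gopmxM ?rpred1 // !mul1r.
set M := submod_repr _ g; set B : 'M_(\rank U, #|G|) := val_submod 1%:M.
have PU : (P <= U)%MS by rewrite eP.
have PQ : in_submod U P *m B = P by rewrite -val_submodE in_submodK.
have BM : B *m aG g = M *m B.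
  by rewrite -[RHS]val_submodE -[M]mul1mx [RHS]val_submodJ.
have BQ : B *m in_submod U P = 1%:M.
  have BP : B *m P = B.
    have /submxP[D ->] : (B <= P)%MS by rewrite -eP val_submodP.
    by rewrite -mulmxA PP.
  by apply: val_submod_inj; rewrite val_submodE -mulmxA PQ BP.
by rewrite -{1}PQ -mulmxA BM mulmxA [RHS]mxtrace_mulC mulmxA BQ mul1mx.
Qed.

End RightIdeal.

Section SpechtChar.

Variables (R : realType) (T : finType) (X : {set T}) (la : seq nat).
Hypothesis sla : sumn la = #|X|.

Lemma polytabloid_young :
  polytabloid R X la = galg_row (Sym_group X) (young R[i] X (tab_of X la)).
Proof.
rewrite /polytabloid.
have -> : \sum_(p in row_stab X la) specht_regular R X p =
    gopmx (Sym_group X) 1 (rsym R[i] X (row_of (tab_of X la))).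
  rewrite gopmx_sumr; apply: eq_bigr => p /stab_Sym pX.
  by rewrite -regular_gopmx.
have -> : \sum_(q in col_stab X la) (-1) ^+ odd_perm q *: specht_regular R X q =
    gopmx (Sym_group X) 1 (csym R[i] X (col_of (tab_of X la))).
  rewrite gopmx_sumr; apply: eq_bigr => q /stab_Sym qX.
  by rewrite gopmxZr -regular_gopmx.
rewrite gopmxM ?rpred1 ?rsym_supp // mulr1; apply/rowP=> j.
by rewrite /gring_row !mxE gring_indexK ?group1 // gdelta1 !mul1r.
Qed.

Lemma specht_dimE : specht_dim R X la = fdim R[i] X la.
Proof.
rewrite /specht_dim /specht_mx polytabloid_young.
by rewrite (cyclic_gopmx (young_supp R[i] X (tab_of X la))).
Qed.

Lemma specht_charE s : s \in Sym X -> specht_char R X la s = alpha R[i] X la s.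
Proof.
move=> sX; rewrite /specht_char /specht_repr.
have tD := tab_ofP sla.
have := mxtrace_cyclic (young_supp R[i] X (tab_of X la)) (young_sqr R[i] tD) (hook_neq0 R[i] tD) sX.
rewrite -polytabloid_young => ->.
(* The trace formula produces the coefficient at [s^-1], which equals the one at [s]. *)
by rewrite -[X in gdelta _ X]invgK gtau_delta ychar_inv.
Qed.

End SpechtChar.

(** * The transition probabilities *)

Section Transition.

Variable R : realType.
Implicit Types la mu : seq nat.

(** Both dimensions count the standard tableaux of [la], whatever the ground set. *)
Lemma part_dimE (T : finType) (X : {set T}) la : part_of #|X| la ->
  part_dim R la = fdim R[i] X la.
Proof.
move=> laX; have /andP[pla /eqP sla] := laX.
have cI : #|[set: 'I_(sumn la)]| = sumn la by rewrite cardsT card_ord.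
have laI : part_of #|[set: 'I_(sumn la)]| la by rewrite /part_of pla cI eqxx.
rewrite /part_dim specht_dimE //.
have [_ ->] := fdim_nsyt R[i] (leqnn #|[set: 'I_(sumn la)]|); last by rewrite mem_parts.
have [_ ->] := fdim_nsyt R[i] (leqnn #|X|); last by rewrite mem_parts.
by rewrite cI sla.
Qed.

Lemma part_dim_nsyt N la : is_part la -> (sumn la <= N)%N ->
  part_dim R la = nsyt N.+1 la.
Proof.
move=> pla laN; have cI : #|[set: 'I_(sumn la)]| = sumn la by rewrite cardsT card_ord.
have laI : part_of #|[set: 'I_(sumn la)]| la by rewrite /part_of pla cI eqxx.
rewrite (part_dimE laI); have [|_ ->//] := @fdim_nsyt R[i] _ [set: 'I_(sumn la)] N.
  by rewrite cI.
by rewrite mem_parts.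
Qed.

Lemma part_dim_gt0 la : is_part la -> (0 < part_dim R la)%N.
Proof.
move=> pla; have cI : #|[set: 'I_(sumn la)]| = sumn la by rewrite cardsT card_ord.
rewrite (@part_dimE _ [set: 'I_(sumn la)]) ?fdim_gt0 ?cI //.
by rewrite /part_of pla eqxx.
Qed.

Lemma p_up_gt0 la mu : is_part la -> is_part mu -> 0 < p_up R la mu.
Proof.
by move=> pla pmu; rewrite divr_gt0 ?mulr_gt0 ?ltr0n ?part_dim_gt0.
Qed.

(** The probabilities add up to 1, and a second addable box takes a positive share. *)
Lemma p_up_lt1 la mu : is_part la -> la != [::] -> mu \in add_box la ->
  p_up R la mu < 1.
Proof.
move=> pla la0 mula; have [nu nula numu] := add_box_two pla la0 mula.
rewrite ltr_pdivrMr ?mulr_gt0 ?ltr0n ?part_dim_gt0 // mul1r -natrM ltr_nat.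
have pD rho : rho \in add_box la -> part_dim R rho = nsyt (sumn la).+2 rho.
  move=> rhola; rewrite (part_dim_nsyt (N := (sumn la).+1)) //.
    by have [] := mem_add_box pla rhola.
  by rewrite (sumn_add_box pla rhola).
rewrite (part_dim_nsyt pla (leqnSn _)) pD // -nsyt_up //.
rewrite (bigD1_seq mu) ?add_box_uniq //= -[X in (X < _)%N]addn0 ltn_add2l.
rewrite (big_rem nu nula) /= numu addn_gt0 -pD // part_dim_gt0 //.
by have [] := mem_add_box pla nula.
Qed.

Lemma le_vartheta la mu : mu \in add_box la -> p_up R la mu <= vartheta R la.
Proof. by move=> mula; apply: le_bigmax_seq. Qed.

Lemma vartheta_attained la : is_part la ->
  exists2 mu, mu \in add_box la & vartheta R la = p_up R la mu.
Proof.
move=> pla; have pos mu : mu \in add_box la -> 0 < p_up R la mu.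
  by move=> /(mem_add_box pla)[pmu _]; apply: p_up_gt0.
have : add_box la != [::].
  apply/eqP=> e; have := part_dim_gt0 pla; rewrite (part_dim_nsyt pla (leqnn _)).
  by have := nsyt_up pla (leqnn _); rewrite e big_nil; case: nsyt.
rewrite /vartheta; elim: (add_box la) pos => // mu s IH pos _.
rewrite big_cons; have [->|s0] := eqVneq s [::].
  exists mu; rewrite ?mem_head // big_nil; apply/max_idPl/ltW/pos.
  exact: mem_head.
have [|nu nus ->] := IH _ s0; first by move=> nu nus; rewrite pos // inE nus orbT.
case: (leP (p_up R la mu) (p_up R la nu)) => _; last by exists mu; rewrite ?mem_head.
by exists nu; rewrite // inE nus orbT.
Qed.

Lemma vartheta_gt0 la : is_part la -> 0 < vartheta R la.
Proof.
move=> pla; have [mu /(mem_add_box pla)[pmu _] ->] := vartheta_attained pla.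
exact: p_up_gt0.
Qed.

Lemma vartheta_lt1 la : is_part la -> la != [::] -> vartheta R la < 1.
Proof.
move=> pla la0; have [mu mula ->] := vartheta_attained pla.
exact: p_up_lt1.
Qed.

End Transition.

(** * Quadratic forms of unitary representations *)

Definition gstar (C : numClosedFieldType) (gT : finGroupType) (x : galg C gT) :
  galg C gT := [ffun g => Num.conj (x g^-1%g)].

Lemma gstarD (C : numClosedFieldType) (gT : finGroupType) (x y : galg C gT) :
  gstar (x + y) = gstar x + gstar y.
Proof. by apply/ffunP=> g; rewrite [LHS]ffunE !galgDE ![in RHS]ffunE rmorphD. Qed.

Lemma gstarM (C : numClosedFieldType) (gT : finGroupType) (x y : galg C gT) :
  gstar (x * y) = gstar y * gstar x.
Proof.
apply/ffunP=> g; rewrite ffunE !galgME rmorph_sum /=.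
rewrite [RHS](reindex_inj (mulgI g)) /=; apply: eq_bigr => h _.
by rewrite !ffunE rmorphM mulrC invMg mulgKV invgK.
Qed.

Lemma gstarZ (C : numClosedFieldType) (gT : finGroupType) a (x : galg C gT) :
  gstar (a *: x) = Num.conj a *: gstar x.
Proof. by apply/ffunP=> g; rewrite [LHS]ffunE !galgZE [in RHS]ffunE rmorphM. Qed.

Section UnitaryForm.

Variables (C : numClosedFieldType) (gT : finGroupType) (d : nat).
Variable rho : mx_representation C [set: gT] d.
Local Notation A := (galg C gT).
Local Notation de := (gdelta C).
Implicit Types (x y : A) (v : 'cV[C]_d).

Definition adjmx m n (M : 'M[C]_(m, n)) : 'M[C]_(n, m) := map_mx Num.conj M^T.

Definition gop x : 'M[C]_d := \sum_g x g *: rho g.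

Lemma gopD x y : gop (x + y) = gop x + gop y.
Proof.
by rewrite /gop -big_split; apply: eq_bigr => g _; rewrite galgDE scalerDl.
Qed.

Lemma gopZ a x : gop (a *: x) = a *: gop x.
Proof.
by rewrite /gop scaler_sumr; apply: eq_bigr => g _; rewrite galgZE scalerA.
Qed.

Lemma gop_delta g : gop (de g) = rho g.
Proof.
rewrite /gop (bigD1 g) //= ffunE eqxx scale1r big1 ?addr0 // => h hg.
by rewrite ffunE (negPf hg) scale0r.
Qed.

Lemma gop_sum I (r : seq I) (P : pred I) (X : I -> A) :
  gop (\sum_(i <- r | P i) X i) = \sum_(i <- r | P i) gop (X i).
Proof.
apply: (big_morph _ gopD).
by rewrite /gop big1 // => g _; rewrite ffunE scale0r.
Qed.

Lemma gopM x y : gop (x * y) = gop x *m gop y.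
Proof.
rewrite galg_mul_expand gop_sum {2}/gop mulmx_suml; apply: eq_bigr => g _.
rewrite gop_sum /gop mulmx_sumr; apply: eq_bigr => h _.
by rewrite -/(gop _) gopZ gop_delta repr_mxM ?inE // -scalemxAr -scalemxAl scalerA mulrC.
Qed.

Lemma adjmxM m n p (M : 'M[C]_(m, n)) (N : 'M_(n, p)) :
  adjmx (M *m N) = adjmx N *m adjmx M.
Proof. by rewrite /adjmx trmx_mul map_mxM. Qed.

Lemma adjmx_form_ge0 n (w : 'cV[C]_n) : 0 <= (adjmx w *m w) 0 0.
Proof.
rewrite mxE; apply: sumr_ge0 => i _; rewrite !mxE mulrC.
exact: mul_conjC_ge0.
Qed.

Lemma adjmx_form_eq0 n (w : 'cV[C]_n) : (adjmx w *m w) 0 0 = 0 -> w = 0.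
Proof.
rewrite mxE => /psumr_eq0P e; apply/colP=> i; apply/eqP; rewrite mxE -mul_conjC_eq0.
have := e _ i isT; rewrite !mxE mulrC => -> // j _.
by rewrite !mxE mulrC mul_conjC_ge0.
Qed.

Hypothesis rhoU : forall g, rho g \is unitarymx.

Lemma adjmx_unitary g : adjmx (rho g) = rho g^-1%g.
Proof.
have e : rho g *m adjmx (rho g) = 1%:M by apply/unitarymxP/rhoU.
have : rho g^-1%g *m (rho g *m adjmx (rho g)) = rho g^-1%g.
  by rewrite e mulmx1.
by rewrite mulmxA -repr_mxM ?inE // mulVg repr_mx1 mul1mx.
Qed.

Lemma adjmx_op x : adjmx (gop x) = gop (gstar x).
Proof.
have adjD : {morph (@adjmx d d) : M N / M + N}.
  by move=> M N; rewrite /adjmx raddfD map_mxD.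
rewrite {1}/gop (big_morph _ adjD (id1 := 0)); last first.
  by apply/matrixP=> i j; rewrite !mxE conjC0.
rewrite /gop (reindex_inj invg_inj) /=; apply: eq_bigr => g _.
rewrite ffunE -[X in _ = _ *: rho X]invgK -adjmx_unitary.
by apply/matrixP=> i j; rewrite !mxE rmorphM /= conjCK invgK.
Qed.

Definition qform v x : C := (adjmx v *m gop x *m v) 0 0.

Lemma qformD v x y : qform v (x + y) = qform v x + qform v y.
Proof. by rewrite /qform gopD mulmxDr mulmxDl mxE. Qed.

Lemma qformZ v a x : qform v (a *: x) = a * qform v x.
Proof. by rewrite /qform gopZ -scalemxAr -scalemxAl mxE. Qed.

Lemma qform_sum v I (r : seq I) (P : pred I) (X : I -> A) :
  qform v (\sum_(i <- r | P i) X i) = \sum_(i <- r | P i) qform v (X i).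
Proof. by rewrite /qform gop_sum mulmx_sumr mulmx_suml summxE. Qed.

(** For a self-adjoint idempotent the form is the squared norm of the image of [v]. *)
Lemma qform_idem_ge0 v x : gstar x = x -> x * x = x -> 0 <= qform v x.
Proof.
move=> xs xx; rewrite /qform -xx gopM -{1}xs -adjmx_op mulmxA -adjmxM -mulmxA.
exact: adjmx_form_ge0.
Qed.

(** Since [e] and [f] commute, [f - f e] is again a self-adjoint idempotent. *)
Lemma qform_proj_le v (e f : A) : gstar e = e -> gstar f = f ->
  e * e = e -> f * f = f -> e * f = f * e -> qform v (f * e) <= qform v f.
Proof.
move=> es fs ee ff ef; rewrite -subr_ge0 -mulN1r -qformZ -qformD.
apply: qform_idem_ge0; first by rewrite gstarD gstarZ gstarM es fs ef rmorphN1.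
have ffe : f * (f * e) = f * e by rewrite mulrA ff.
have fef : (f * e) * f = f * e by rewrite -ef -mulrA ff.
have fefe : (f * e) * (f * e) = f * e by rewrite mulrA fef -mulrA ee.
rewrite scaleN1r mulrDl !mulrDr !mulrN !mulNr opprK ff ffe fef fefe.
by rewrite addNr addr0.
Qed.

End UnitaryForm.

(** * The local inequality *)

Section Local.

Variables (C : numClosedFieldType) (T : finType).
Local Notation A := (galg C {perm T}).
Implicit Types (X Z : {set T}) (la mu : seq nat).

Lemma gstar_alpha X la : gstar (alpha C X la) = alpha C X la.
Proof.
apply/ffunP=> g; rewrite ffunE ychar_inv conj_Creal //.
exact: ychar_real.
Qed.

Lemma gstar_eproj X la : gstar (eproj C X la) = eproj C X la.
Proof.
by rewrite /eproj gstarZ gstar_alpha fmorph_div !rmorph_nat.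
Qed.

(** The vanishing trace is a rank, so the whole operator [x |-> c x e] is zero; applied to group
    elements this kills every conjugate of [c] multiplied by [e]. *)
Lemma alpha_eproj_eq0 X z la mu : z \notin X ->
  part_of #|X| la -> part_of #|X|.+1 mu -> mu \notin add_box la ->
  alpha C (z |: X) mu * eproj C X la = 0.
Proof.
move=> zX laP muP /negPf nmula; have := gtau_alpha_eprojE C zX laP muP.
rewrite nmula; have /andP[_ /eqP sla] := laP; have /andP[_ /eqP smu] := muP.
have cZ : #|z |: X| = #|X|.+1 by rewrite cardsU1 zX.
have tD : is_tab (z |: X) mu (tab_of (z |: X) mu) by apply: tab_ofP; rewrite cZ.
rewrite (gtau_alpha_eproj C (subsetUr _ _) sla tD) => /eqP.
rewrite pnatr_eq0 mxrank_eq0 => /eqP /matrixP M0.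
have eZ : eproj C X la \in gsupp (Sym_group (z |: X)).
  exact: gsupp_sub (subsetUr _ _) (eproj_supp _ _ _).
have y0 g : g \in Sym (z |: X) ->
    young C (z |: X) (tab_of (z |: X) mu) * gdelta C g * eproj C X la = 0.
  move=> gZ; apply/ffunP=> k; rewrite [RHS]ffunE.
  have [kZ|kZ] := boolP (k \in Sym (z |: X)).
    have := M0 (enum_rank_in gZ g) (enum_rank_in kZ k).
    by rewrite !mxE !enum_rankK_in.
  have /gsuppP -> // : young C (z |: X) (tab_of (z |: X) mu) * gdelta C g * eproj C X la
      \in gsupp (Sym_group (z |: X)).
  by rewrite rpredM // rpredM ?young_supp ?gsupp_delta.
rewrite /alpha /ychar; move: (young C _ _) y0 => y y0.
rewrite -scalerAl mulr_suml big1 ?scaler0 // => g gZ.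
by rewrite -2!mulrA y0 ?mulr0.
Qed.

Lemma eproj_branch X z la : z \notin X -> part_of #|X| la ->
  eproj C X la = \sum_(mu <- add_box la) eproj C (z |: X) mu * eproj C X la.
Proof.
move=> zX laP; have /andP[pla /eqP sla] := laP.
have cZ : #|z |: X| = #|X|.+1 by rewrite cardsU1 zX.
rewrite -[LHS]mul1r -(completeT C (z |: X)) cZ mulr_suml.
rewrite (eq_big_seq (fun mu => if mu \in add_box la
    then eproj C (z |: X) mu * eproj C X la else 0)).
  rewrite -big_mkcond -big_filter; apply/perm_big/uniq_perm.
  - by rewrite filter_uniq ?parts_uniq.
  - exact: add_box_uniq.
  move=> mu; rewrite mem_filter mem_parts; apply: andb_idr => mula.
  by rewrite /part_of (mem_add_box pla mula).1 (sumn_add_box pla mula) sla eqxx.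
move=> mu; rewrite mem_parts => muP; case: ifPn => // nmula.
by rewrite {1}/eproj -scalerAl alpha_eproj_eq0 ?scaler0.
Qed.

Lemma sum_alpha_eproj Z la mu n : #|Z| = n.+1 -> part_of n la ->
  mu \in add_box la ->
  (\sum_(j in Z) alpha C (Z :\ j) la) * eproj C Z mu = alpha C Z mu.
Proof.
move=> cZ laP mula; have /andP[pla /eqP sla] := laP.
have boxP nu : nu \in add_box la -> part_of #|Z| nu.
  move=> nula; rewrite /part_of (mem_add_box pla nula).1.
  by rewrite (sumn_add_box pla nula) sla cZ eqxx.
rewrite (sum_alpha_branch C cZ laP) mulr_suml.
rewrite (bigD1_seq mu) ?add_box_uniq //= big1_seq ?addr0; last first.
  move=> nu /andP[numu nula]; rewrite /eproj -scalerAr alpha_orth ?scaler0 ?boxP //.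
have /andP[_ /eqP smu] := boxP _ mula.
rewrite [X in X * _]alpha_eproj // -scalerAl eproj_sqr // -alpha_eproj //.
Qed.

Variables (d : nat) (rho : mx_representation C [set: {perm T}] d).
Hypothesis rhoU : forall g, rho g \is unitarymx.
Variable v : 'cV[C]_d.

Lemma qform_alpha_ge0 X la : sumn la = #|X| -> 0 <= qform rho v (alpha C X la).
Proof.
move=> sla; rewrite alpha_eproj // qformZ mulr_ge0 ?divr_ge0 ?ler0n //.
by apply: qform_idem_ge0; rewrite ?gstar_eproj ?eproj_sqr.
Qed.

(* [eproj_X * eproj_Z] is again a self-adjoint projection, below [eproj_Z]. *)
Lemma qform_alpha_local Z z la n (theta : C) : #|Z| = n.+1 -> z \in Z ->
    part_of n la ->
    {in add_box la, forall mu,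
      (fdim C Z mu)%:R / (n.+1%:R * (fdim C (Z :\ z) la)%:R) <= theta} ->
  qform rho v (alpha C (Z :\ z) la)
    <= theta * \sum_(j in Z) qform rho v (alpha C (Z :\ j) la).
Proof.
move=> cZ zZ laP le_theta; have /andP[pla /eqP sla] := laP.
have cX : #|Z :\ z| = n by move: cZ; rewrite (cardsD1 z) zZ => -[].
have zX : z \notin Z :\ z by rewrite !inE eqxx.
have slaX : sumn la = #|Z :\ z| by rewrite cX.
rewrite -qform_sum (sum_alpha_branch C cZ laP) qform_sum alpha_eproj // qformZ.
have := @eproj_branch (Z :\ z) z la zX; rewrite cX setD1K // => -> //.
rewrite qform_sum !mulr_sumr big_seq [leRHS]big_seq; apply: ler_sum => mu mula.
have smu : sumn mu = #|Z| by rewrite (sumn_add_box pla mula) sla cZ.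
have f0 X nu : sumn nu = #|X| -> (fdim C X nu)%:R != 0 :> C.
  by move=> snu; rewrite pnatr_eq0 -lt0n fdim_gt0.
set eX := eproj C (Z :\ z) la; set eZ := eproj C Z mu.
have comm : eX * eZ = eZ * eX.
  by apply: eproj_comm; apply: gsupp_sub (subsetDl _ _) (eproj_supp _ _ _).
have eXX : eX * eX = eX by apply: eproj_sqr.
have eZZ : eZ * eZ = eZ by apply: eproj_sqr.
have sX : gstar eX = eX by apply: gstar_eproj.
have sZ : gstar eZ = eZ by apply: gstar_eproj.
have le1 : qform rho v (eZ * eX) <= qform rho v eZ.
  exact: (qform_proj_le rhoU v sX sZ eXX eZZ comm).
have ge0 : 0 <= qform rho v (alpha C Z mu) by apply: qform_alpha_ge0.
apply: le_trans (ler_wpM2r ge0 (le_theta mu mula)).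
rewrite [alpha C Z mu](alpha_eproj C smu) qformZ mulrA -/eZ cZ factS natrM.
have fX0 := f0 _ _ slaX; have fZ0 := f0 _ _ smu.
have n0 : n.+1%:R != 0 :> C by rewrite pnatr_eq0.
(* The origin of the transition probability: [n! / f^la] is [p_up(la, mu)] times
   [(n + 1)! / f^mu]. *)
have -> : (fdim C Z mu)%:R / (n.+1%:R * (fdim C (Z :\ z) la)%:R)
    * (n.+1%:R * (n`!)%:R / (fdim C Z mu)%:R) = (n`!)%:R / (fdim C (Z :\ z) la)%:R :> C.
  by move: (n.+1%:R : C) n0 => m m0; field; rewrite fX0 fZ0 m0.
by rewrite ler_wpM2l // divr_ge0 ?ler0n.
Qed.

End Local.

(** * Summing the local inequalities *)

Section WeightedSum.

(** Here [q X] stands for the value of the quadratic form on [alpha X la], [y i] for the inverse of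
    the weight at [i], and [z] for the index with the negative weight. *)
Variables (R : realFieldType) (T : finType) (z : T) (k : nat).
Variables (q : {set T} -> R) (y : T -> R) (theta a : R).
Hypotheses (q_ge0 : forall X : {set T}, #|X| = k -> 0 <= q X).
Hypotheses (y_gt0 : forall i, i != z -> 0 < y i) (a_gt0 : 0 < a).
Hypothesis theta_lt1 : theta < 1.
Hypothesis q_local : forall X : {set T}, z \notin X -> #|X| = k ->
  q X <= theta * \sum_(j in z |: X) q ((z |: X) :\ j).
Hypothesis y_le : forall Y : {set T}, z \in Y -> #|Y| = k ->
  theta / (1 - theta) * \sum_(j in ~: Y) y j <= a.

Let w i := if i == z then - a^-1 else (y i)^-1.
Let V (X : {set T}) := \prod_(i in ~: X | i != z) (y i)^-1.

Let V_ge0 X : 0 <= V X.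
Proof. by apply: prodr_ge0 => i /andP[_ iz]; rewrite invr_ge0 ltW ?y_gt0. Qed.

Let w_in (X : {set T}) : z \in X -> \prod_(i in ~: X) w i = V X.
Proof.
move=> zX; rewrite /V; apply: eq_big => [i|i]; rewrite inE.
  by rewrite andb_idr //; apply: contra => /eqP->.
by move=> iX; rewrite /w; case: eqP iX => // ->; rewrite zX.
Qed.

Let w_notin (X : {set T}) : z \notin X -> \prod_(i in ~: X) w i = - a^-1 * V X.
Proof.
move=> zX; rewrite (bigD1 z) ?inE //= {1}/w eqxx; congr (_ * _).
by apply: eq_bigr => i /andP[_ iz]; rewrite /w (negPf iz).
Qed.

(* Exchanging [j] with [z] matches the sets containing [j] but not [z] with
   those containing [z] but not [j]. *)
Let swap j (X : {set T}) : {set T} := tperm j z @: X.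

Let swapK j : involutive (swap j).
Proof.
move=> X; rewrite /swap -imset_comp -[RHS]imset_id; apply: eq_imset => i /=.
by rewrite tpermK.
Qed.

Let swapE j (X : {set T}) : j \in X -> z \notin X -> swap j X = z |: X :\ j.
Proof.
move=> jX zX; apply/setP=> i; rewrite -(tpermK j z i) /swap mem_imset; last exact: perm_inj.
rewrite tpermK !inE; case: tpermP => [->|->|/eqP ij /eqP iz].
- by rewrite eqxx (negPf zX) orbF; apply/esym/negbTE; apply: contraNneq zX => <-.
- by rewrite eqxx jX.
by rewrite ij (negPf iz).
Qed.

(** The term [j = z] of the local inequality is [q X] itself; moving it to the left turns [theta]
    into [theta / (1 - theta)]. *)
Let q_kappa (X : {set T}) : z \notin X -> #|X| = k ->
  q X <= theta / (1 - theta) * \sum_(j in X) q (swap j X).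
Proof.
move=> zX cX; have := q_local zX cX; rewrite big_setU1 //= setU1K //.
rewrite (eq_bigr (fun j => q (swap j X))) => [|j jX]; last first.
  rewrite swapE // setDUl (setDidPl _) // disjoints1 inE.
  by apply: contraNneq zX => ->.
set S := \sum_(j in X) _; rewrite mulrAC ler_pdivlMr ?subr_gt0 //; nra.
Qed.

Let V_swap j (X : {set T}) : j \in X -> z \notin X -> V X = V (swap j X) * y j.
Proof.
move=> jX zX; have jz : j != z by apply: contraNneq zX => <-.
rewrite {2}/V (bigD1 j) /=; last by rewrite swapE // !inE eqxx (negPf jz).
rewrite mulrAC mulVf ?gt_eqF ?y_gt0 // mul1r; apply: eq_bigl => i.
rewrite swapE // !inE; case: (i =P j) => [->|_]; first by rewrite jX andbF.
by case: (i =P z); rewrite ?andbF ?andbT.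
Qed.

(** Exactly the sets avoiding [z] carry the factor [- a^-1]. Through the swaps they are charged to
    the sets [Y] containing [z], each of which receives its own term times [theta / (1 - theta) *
    \sum_(j in ~: Y) y j], at most [a]. *)
Lemma weighted_sum_ge0 :
  0 <= \sum_(X : {set T} | #|X| == k) (\prod_(i in ~: X) w i) * q X.
Proof.
rewrite (bigID (fun X : {set T} => z \in X)) /=.
rewrite (eq_bigr (fun X => V X * q X)) => [|X /andP[_ zX]]; last by rewrite w_in.
rewrite [X in _ + X](eq_bigr (fun X => - a^-1 * (V X * q X))); last first.
  by move=> X /andP[_ zX]; rewrite w_notin // mulrA.
rewrite -mulr_sumr mulNr subr_ge0 mulrC ler_pdivrMr //.
apply: (@le_trans _ _ (\sum_(X : {set T} | (#|X| == k) && (z \notin X))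
    \sum_(j in X) theta / (1 - theta) * (V (swap j X) * y j * q (swap j X)))).
  apply: ler_sum => X /andP[/eqP cX zX].
  apply: le_trans (ler_wpM2l (V_ge0 X) (q_kappa zX cX)) _.
  rewrite mulrCA mulr_sumr mulr_sumr; apply: ler_sum => j jX.
  by rewrite (V_swap jX zX).
rewrite (exchange_big_dep predT) //=.
rewrite (eq_bigr (fun j => \sum_(Y : {set T} | (#|Y| == k) && (z \in Y) && (j \notin Y))
    theta / (1 - theta) * (V Y * y j * q Y))); last first.
  move=> j _; rewrite (reindex_inj (inv_inj (swapK j))) /=.
  apply: eq_big => [X|X _]; last by rewrite swapK.
  have zE : (z \in swap j X) = (j \in X).
    by rewrite -{1}(tpermL j z) mem_imset //; apply: perm_inj.
  have jE : (j \in swap j X) = (z \in X).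
    by rewrite -{1}(tpermR j z) mem_imset //; apply: perm_inj.
  rewrite zE jE card_imset; last exact: perm_inj.
  by rewrite -!andbA (andbC (_ \notin _)).
rewrite (exchange_big_dep (fun Y : {set T} => (#|Y| == k) && (z \in Y))) /=; last first.
  by move=> j Y _ /andP[].
rewrite mulr_suml; apply: ler_sum => Y /andP[cY zY].
rewrite (eq_bigl (fun j => j \in ~: Y)) => [|j]; last by rewrite inE cY zY.
rewrite (eq_bigr (fun j => (V Y * q Y) * (theta / (1 - theta) * y j))); last by move=> j _; ring.
rewrite -mulr_sumr -mulr_sumr; apply: ler_wpM2l; last exact: y_le zY (eqP cY).
by rewrite mulr_ge0 ?q_ge0 //; apply/eqP.
Qed.

End WeightedSum.

Lemma sum_nonincreasing_le (R : realFieldType) (x : nat -> R) (P : pred nat) m :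
  (forall i j, (i <= j < m)%N -> x j <= x i) ->
  \sum_(0 <= j < m | P j) x j <= \sum_(0 <= i < \sum_(0 <= j < m) P j) x i.
Proof.
elim: m => [|m IH] mono; first by rewrite !big_geq.
have IHm : \sum_(0 <= j < m | P j) x j <= \sum_(0 <= i < \sum_(0 <= j < m) P j) x i.
  by apply: IH => i j /andP[ij jm]; rewrite mono // ij ltnW.
rewrite big_mkcond !big_nat_recr //= -big_mkcond /=.
case: (P m); last by rewrite addr0 addn0.
rewrite addn1 big_nat_recr //= lerD // mono // ltnSn andbT.
rewrite -[X in (_ <= X)%N]subn0 -[X in (_ <= X)%N]muln1 -sum_nat_const_nat.
by apply: leq_sum => i _; case: (P i).
Qed.

(** * The regular representation *)

Section Regular.

Variables (C : numClosedFieldType) (gT : finGroupType).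
Local Notation G := [set: gT]%G.
Local Notation reg := (regular_repr C G).
Implicit Type x : galg C gT.

Lemma gop_regular x : gop reg x = gopmx G 1 x.
Proof.
rewrite {2}[x]galg_expand gopmx_sumr; apply: eq_bigr => g _.
by rewrite gopmxZr -regular_gopmx ?inE.
Qed.

Lemma gop_regular_eq0 x : gop reg x = 0 -> x = 0.
Proof.
rewrite gop_regular => /matrixP M0; apply/ffunP=> g; rewrite [RHS]ffunE.
have := M0 (enum_rank_in (group1 G) 1%g) (enum_rank_in (group1 G) g).
by rewrite !mxE !enum_rankK_in ?inE // gdelta1 !mul1r.
Qed.

Lemma regular_unitary g : reg g \is unitarymx.
Proof.
apply/unitarymxP; rewrite -(repr_mx1 reg) -(mulgV g) repr_mxM ?inE //.
congr (_ *m _); apply/matrixP=> i j.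
rewrite !regular_gopmx ?inE // !mxE !mul1r -!gdeltaM !ffunE conjC_nat.
by congr (_ : bool)%:R; apply/eqP/eqP => ->; rewrite ?mulgK ?mulgKV.
Qed.

End Regular.

(** * Plucker coordinates *)

Section Eigen.

Variables (C : numClosedFieldType) (T : finType) (Z : {set T}) (z : T).
Variables (la mu : seq nat) (n : nat).
Hypotheses (cZ : #|Z| = n.+1) (zZ : z \in Z) (laP : part_of n la).
Hypothesis mula : mu \in add_box la.

Local Notation eX := (eproj C (Z :\ z) la).
Local Notation eZ := (eproj C Z mu).

Let cX : #|Z :\ z| = n.
Proof. by move: cZ; rewrite (cardsD1 z) zZ => -[]. Qed.

Let slaX : sumn la = #|Z :\ z|.
Proof. by rewrite cX; have /andP[_ /eqP] := laP. Qed.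

Let muZ : part_of #|Z| mu.
Proof.
have /andP[pla /eqP sla] := laP.
by rewrite /part_of (mem_add_box pla mula).1 (sumn_add_box pla mula) sla cZ eqxx.
Qed.

Lemma eproj_branch_neq0 : eZ * eX <> 0.
Proof.
move=> e0; have zX : z \notin Z :\ z by rewrite !inE eqxx.
have := @gtau_alpha_eprojE C _ (Z :\ z) z la mu zX.
rewrite cX setD1K // => /(_ laP); rewrite -cZ => /(_ muZ); rewrite mula.
rewrite [alpha C Z mu]alpha_eproj; last by have /andP[_ /eqP] := muZ.
rewrite -scalerAl e0 scaler0 /gtau ffunE => /esym/eqP.
by rewrite pnatr_eq0 (gtn_eqF (fdim_gt0 C slaX)).
Qed.

(** On the image of [eZ * eX] the sum over [j] and the term at [z] both act by scalars, so their
    combination has an explicit eigenvalue. *)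
Lemma eproj_branch_eigen (b : C) :
  (\sum_(j in Z) alpha C (Z :\ j) la - b *: alpha C (Z :\ z) la) * (eZ * eX)
    = ((#|Z|`!)%:R / (fdim C Z mu)%:R
        - b * ((#|Z :\ z|`!)%:R / (fdim C (Z :\ z) la)%:R)) *: (eZ * eX).
Proof.
have ef : eX * eZ = eZ * eX.
  by apply: eproj_comm; apply: gsupp_sub (subsetDl _ _) (eproj_supp _ _ _).
have ee : eX * eX = eX by apply: eproj_sqr.
have smu : sumn mu = #|Z| by have /andP[_ /eqP] := muZ.
have := sum_alpha_eproj C cZ laP mula; rewrite [alpha C Z mu](alpha_eproj C smu).
rewrite (alpha_eproj C slaX); move: (\sum_(j in Z) _) eX eZ ef ee => c e f ef ee cf.
rewrite mulrBl scalerA -scalerAl !mulrA cf ef -(mulrA f e e) ee.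
by rewrite -scalerAl -scalerBl.
Qed.

End Eigen.

Section Plucker.

Variable R : realType.
Implicit Types (n k : nat) (la : seq nat).

Lemma plucker_alpha n la (u : 'I_n -> R[i]) :
  plucker la u = \sum_(X : {set 'I_n} | #|X| == sumn la)
    (\prod_(a in ~: X) u a) *: alpha R[i] X la :> galg R[i] 'S_n.
Proof.
apply/ffunP=> s; rewrite ffunE galg_sumE big_mkcondr; apply: eq_bigr => X /eqP cX.
rewrite galgZE mulrC; case: ifPn => sX; first by rewrite specht_charE.
by have /gsuppP-> := alpha_supp R[i] X la; rewrite ?mulr0.
Qed.

Lemma real_complex_prod I (r : seq I) (P : pred I) (w : I -> R) :
  \prod_(i <- r | P i) (w i)%:C%C = (\prod_(i <- r | P i) w i)%:C%C.
Proof. by rewrite rmorph_prod. Qed.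

Lemma plucker_selfadjoint n la (w : 'I_n -> R) :
  galg_selfadjoint (plucker la (fun i => (w i)%:C%C)).
Proof.
change (gstar (plucker la (fun i => (w i)%:C%C) : galg R[i] 'S_n)
  = plucker la (fun i => (w i)%:C%C)).
rewrite plucker_alpha.
under eq_bigr => X _ do rewrite real_complex_prod.
have gstar0 : gstar (0 : galg R[i] 'S_n) = 0.
  by apply/ffunP=> g; rewrite !ffunE conjC0.
rewrite (big_morph _ (@gstarD _ _) gstar0); apply: eq_bigr => X _.
rewrite gstarZ gstar_alpha; congr (_ *: _); exact: conjc_real.
Qed.

Lemma ratio_complex (m n : nat) : (m%:R / n%:R : R)%:C%C = m%:R / n%:R :> R[i].
Proof. by rewrite fmorph_div !rmorph_nat. Qed.

Lemma psd_op (gT : finGroupType) d (rho : mx_representation R[i] [set: gT] d) (A : galg R[i] gT) :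
  unitary_repr rho -> galg_selfadjoint A ->
  (forall v, 0 <= qform rho v A) -> psd_mx (galg_op rho A).
Proof.
move=> rhoU As A0; split=> //.
by rewrite -[RHS]/(gop rho A) -[in RHS]As -(adjmx_op rhoU).
Qed.

Lemma ge0_Re (c : R[i]) : 0 <= c -> c = (complex.Re c)%:C%C.
Proof. by move=> /ger0_real/RRe_real. Qed.

Lemma p_upE (T : finType) (Z : {set T}) z la mu n : #|Z| = n.+1 -> z \in Z ->
  part_of n la -> mu \in add_box la ->
  (fdim R[i] Z mu)%:R / (n.+1%:R * (fdim R[i] (Z :\ z) la)%:R) = (p_up R la mu)%:C%C.
Proof.
move=> cZ zZ laP mula; have /andP[pla /eqP sla] := laP.
have cX : #|Z :\ z| = n by move: cZ; rewrite (cardsD1 z) zZ => -[].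
have muZ : part_of #|Z| mu.
  by rewrite /part_of (mem_add_box pla mula).1 (sumn_add_box pla mula) sla cZ eqxx.
rewrite /p_up (part_dimE R muZ) (@part_dimE R _ (Z :\ z) la) ?cX // sla.
by rewrite fmorph_div rmorphM !rmorph_nat.
Qed.

(** The complement of [Y] has [n.+1 - k] elements and avoids the last index, so monotonicity
    compares it with the first [n.+1 - k] of the [x i]. *)
Lemma sum_weights_le n k (x : nat -> R) (Y : {set 'I_n.+1}) :
  (forall i j, (1 <= i)%N -> (i <= j)%N -> (j <= n)%N -> x j <= x i) ->
  ord_max \in Y -> #|Y| = k ->
  \sum_(j in ~: Y) x j.+1 <= \sum_(1 <= i < (n.+1 - k).+1) x i.
Proof.
move=> mono zY cY; rewrite big_add1 /=.
pose P j := [exists i : 'I_n.+1, (i \notin Y) && (j == i :> nat)].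
have PE (i : 'I_n.+1) : P i = (i \in ~: Y).
  rewrite inE; apply/existsP/idP => [[j /andP[jY /eqP/val_inj->]] //|iY].
  by exists i; rewrite iY eqxx.
have Pn : P n = false by rewrite (PE ord_max) inE zY.
have -> : \sum_(j in ~: Y) x j.+1 = \sum_(0 <= j < n | P j) x j.+1.
  rewrite (eq_bigl (fun i : 'I_n.+1 => P i)) => [|i]; last by rewrite PE.
  by rewrite -(big_mkord P (fun j => x j.+1)) big_mkcond big_nat_recr //= Pn addr0 -big_mkcond.
have -> : (n.+1 - k = \sum_(0 <= j < n) P j)%N.
  rewrite -cY -[X in (X - _)%N]card_ord -(setCK Y) -cardsCs.
  transitivity (\sum_(0 <= j < n.+1) P j)%N; last by rewrite big_nat_recr //= Pn addn0.
  rewrite big_mkord -sum1_card big_mkcond; apply: eq_bigr => i _.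
  by rewrite PE; case: (i \in ~: Y).
apply: (sum_nonincreasing_le (x := fun j => x j.+1)) => i j /andP[ij jn].
exact: mono.
Qed.

(** * Positivity *)

Lemma plucker_psd n k la (w : 'I_n.+1 -> R) (a : R) :
  (1 <= k)%N -> part_of k la -> 0 < a -> w ord_max = - a^-1 ->
  (forall i, i != ord_max -> 0 < w i) ->
  (forall Y : {set 'I_n.+1}, ord_max \in Y -> #|Y| = k ->
     vartheta R la / (1 - vartheta R la) * \sum_(j in ~: Y) (w j)^-1 <= a) ->
  galg_psd (plucker la (fun i => (w i)%:C%C)).
Proof.
move=> k1 laP a0 wz w0 w_le d rho rhoU; have /andP[pla /eqP sla] := laP.
have la0 : la != [::] by apply: contraTneq k1 => la0; rewrite -sla la0.
apply: psd_op (plucker_selfadjoint _ _) _ => // v.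
(* These values are nonnegative, hence real, so real parts lose nothing and the weighted sum can be
   estimated over [R]. *)
pose q (X : {set 'I_n.+1}) := complex.Re (qform rho v (alpha R[i] X la)).
have qE (X : {set 'I_n.+1}) : #|X| = k -> qform rho v (alpha R[i] X la) = (q X)%:C%C.
  by move=> cX; apply/ge0_Re/qform_alpha_ge0; rewrite ?cX.
have q0 (X : {set 'I_n.+1}) : #|X| = k -> 0 <= q X.
  by move=> cX; rewrite -ler0c -qE // qform_alpha_ge0 ?cX.
rewrite plucker_alpha qform_sum.
have -> : \sum_(X : {set 'I_n.+1} | #|X| == sumn la)
    qform rho v ((\prod_(i in ~: X) (w i)%:C%C) *: alpha R[i] X la) =
    (\sum_(X : {set 'I_n.+1} | #|X| == k) (\prod_(i in ~: X) w i) * q X)%:C%C.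
  rewrite rmorph_sum /= sla; apply: eq_bigr => X /eqP cX.
  by rewrite qformZ qE // real_complex_prod rmorphM.
rewrite ler0c.
have := @weighted_sum_ge0 R 'I_n.+1 ord_max k q (fun i => (w i)^-1) (vartheta R la) a q0.
rewrite (eq_bigr (fun X => (\prod_(i in ~: X) w i) * q X)); last first.
  move=> X _; congr (_ * _); apply: eq_bigr => i _.
  by case: eqP => [->|]; rewrite ?wz ?invrK.
apply=> //.
- by move=> i iz; rewrite invr_gt0 w0.
- exact: vartheta_lt1.
move=> X zX cX; set Z := ord_max |: X.
have cZ : #|Z| = k.+1 by rewrite cardsU1 zX cX.
have zZ : ord_max \in Z by rewrite setU11.
have ZX : Z :\ ord_max = X by rewrite setU1K.
have e1 : qform rho v (alpha R[i] (Z :\ ord_max) la) = (q X)%:C%C.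
  by rewrite ZX; apply: qE.
have e2 : \sum_(j in Z) qform rho v (alpha R[i] (Z :\ j) la)
    = (\sum_(j in Z) q (Z :\ j))%:C%C.
  rewrite rmorph_sum; apply: eq_bigr => j jZ; apply: qE.
  by move: cZ; rewrite (cardsD1 j) jZ => -[].
have thetaC : {in add_box la, forall mu, (fdim R[i] Z mu)%:R /
    (k.+1%:R * (fdim R[i] (Z :\ ord_max) la)%:R) <= (vartheta R la)%:C%C}.
  by move=> mu mula; rewrite (p_upE cZ zZ laP mula) lecR le_vartheta.
have le : qform rho v (alpha R[i] (Z :\ ord_max) la)
    <= (vartheta R la)%:C%C * \sum_(j in Z) qform rho v (alpha R[i] (Z :\ j) la).
  exact: (qform_alpha_local rhoU v cZ zZ laP thetaC).
have sub (b b' c c' t : R[i]) : b = b' -> c = c' -> b <= t * c -> b' <= t * c' by move=> -> ->.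
by rewrite -lecR rmorphM; apply: sub e1 e2 le.
Qed.

(** * Sharpness *)

Lemma big_cosingle (T : finType) (V : nmodType) (G : {set T} -> V) k :
  #|T| = k.+1 ->
  \sum_(X : {set T} | #|X| == k) G X = \sum_(j in [set: T]) G ([set: T] :\ j).
Proof.
move=> cT; rewrite (reindex_inj (@setC_inj T)) /=.
under [RHS]eq_bigr => j _ do rewrite setTD.
rewrite -(big_imset (fun Y => G (~: Y)) (h := fun j => [set j])) /=; last first.
  by move=> i j _ _; apply: set1_inj.
apply: eq_bigl => Y; have := cardsC Y; rewrite cT => cY.
apply/eqP/imsetP => [cY'|[j _ ->]].
  have /cards1P[j ->] : #|Y| == 1%N by apply/eqP; lia.
  by exists j.
by have := cardsC [set j]; rewrite cT cards1; lia.
Qed.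

(** Writing [- a^-1] as [1 - (1 + a^-1)] completes the sum over all [j], which commutes with every
    permutation, and isolates one term at the last index. *)
Lemma plucker_cosingle k la (a : R) (Z := [set: 'I_k.+1]) : sumn la = k ->
  plucker la (fun i : 'I_k.+1 => (if i == ord_max then - a^-1 else 1)%:C%C)
  = \sum_(j in Z) alpha R[i] (Z :\ j) la
      - (1 + a^-1)%:C%C *: alpha R[i] (Z :\ ord_max) la :> galg R[i] 'S_k.+1.
Proof.
move=> sla; rewrite plucker_alpha sla (@big_cosingle _ _ _ k) ?card_ord //.
rewrite (bigD1 ord_max) ?inE //= [in RHS](bigD1 ord_max) ?inE //=.
have w1 j : \prod_(i in ~: (Z :\ j)) (if i == ord_max then - a^-1 else 1)%:C%C =
    (if j == ord_max then - a^-1 else 1)%:C%C :> R[i].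
  by rewrite setTD setCK big_set1.
rewrite w1 eqxx (eq_bigr (fun j => alpha R[i] (Z :\ j) la)) => [|j /andP[_ jz]]; last first.
  by rewrite w1 (negPf jz) scale1r.
move: (alpha _ _ _) (\sum_(_ | _) _) => b c.
rewrite addrAC; congr (_ + c); rewrite rmorphN scaleNr rmorphD scalerDl scale1r.
by rewrite opprD addrA subrr add0r.
Qed.

Lemma plucker_not_psd k la (a : R) :
  (1 <= k)%N -> part_of k la -> 0 < a ->
  a < vartheta R la / (1 - vartheta R la) ->
  ~ galg_psd (plucker la (fun i : 'I_k.+1 => (if i == ord_max then - a^-1 else 1)%:C%C)).
Proof.
move=> k1 laP a0 alt psd; have /andP[pla /eqP sla] := laP.
have la0 : la != [::] by apply: contraTneq k1 => la0; rewrite -sla la0.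
have [mu mula thetaE] := vartheta_attained R pla.
have theta_lt1 := vartheta_lt1 R pla la0.
pose Z := [set: 'I_k.+1].
have cZ : #|Z| = k.+1 by rewrite cardsT card_ord.
have zZ : ord_max \in Z by rewrite inE.
pose h (m f : nat) : R := (m`!)%:R / f%:R.
pose r := h #|Z| (fdim R[i] Z mu)
  - (1 + a^-1) * h #|Z :\ ord_max| (fdim R[i] (Z :\ ord_max) la).
have r_lt0 : r < 0.
  have cX : #|Z :\ ord_max| = k by move: cZ; rewrite (cardsD1 ord_max) zZ => -[].
  have smu : sumn mu = #|Z| by rewrite (sumn_add_box pla mula) sla cZ.
  have muZ : part_of #|Z| mu by rewrite /part_of (mem_add_box pla mula).1 smu eqxx.
  have laX : part_of #|Z :\ ord_max| la by rewrite cX.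
  set m := h #|Z| _ in r *.
  have m0 : 0 < m by rewrite divr_gt0 ?ltr0n ?fact_gt0 ?fdim_gt0.
  have key : h #|Z :\ ord_max| (fdim R[i] (Z :\ ord_max) la) = m * vartheta R la.
    rewrite thetaE /p_up (part_dimE R muZ) (part_dimE R laX) sla.
    have : (fdim R[i] Z mu)%:R != 0 :> R by rewrite pnatr_eq0 -lt0n fdim_gt0.
    have : (fdim R[i] (Z :\ ord_max) la)%:R != 0 :> R.
      by rewrite pnatr_eq0 -lt0n fdim_gt0 // cX.
    have : k.+1%:R != 0 :> R by rewrite pnatr_eq0.
    rewrite /m /h cZ cX factS natrM.
    move: (k.+1%:R : R) => n0 n00 n20 n30.
    by field; rewrite n00 n20 n30.
  (* The factor after [m] is negative precisely when [a < theta / (1 - theta)]. *)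
  have -> : r = m * (1 - (1 + a^-1) * vartheta R la) by rewrite /r key; ring.
  rewrite pmulr_rlt0 // subr_lt0.
  move: alt; rewrite ltr_pdivlMr ?subr_gt0 // => alt.
  rewrite -(ltr_pM2l a0) mulr1 mulrA mulrDr mulr1 mulfV ?gt_eqF //.
  by lra.
have := @eproj_branch_neq0 R[i] _ Z ord_max la mu k cZ zZ laP mula.
have := @eproj_branch_eigen R[i] _ Z ord_max la mu k cZ zZ laP mula (1 + a^-1)%:C%C.
rewrite -!ratio_complex -/(h _ _) -/(h _ _) -rmorphM -rmorphB -/r.
rewrite /Z -plucker_cosingle //.
move: (eproj _ _ _ * _) (plucker _ _) psd => u P psd Pu u0.
pose rho := regular_repr R[i] [set: 'S_k.+1]%G.
have [_ psd0] := psd _ rho (@regular_unitary _ _).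
(* The regular representation is faithful, so [u] acts by a nonzero matrix. Any nonzero column of it
   is an eigenvector for [r < 0], contradicting positivity. *)
have [j wj] : exists j, col j (gop rho u) != 0.
  apply/existsP; apply: contra_notT u0 => /existsPn cj; apply: (@gop_regular_eq0 R[i]).
  apply/matrixP=> i j; move: (cj j); rewrite negbK => /eqP /colP/(_ i).
  by rewrite !mxE.
set w := col j _ in wj.
have Pw : gop rho P *m w = r%:C%C *: w.
  by rewrite /w colE mulmxA -gopM Pu gopZ -scalemxAl.
have : 0 <= (adjmx w *m gop rho P *m w) 0 0 := psd0 w.
rewrite -mulmxA Pw -scalemxAr mxE nmulr_rge0 ?ltcR // => le0.
case/eqP: wj; apply: adjmx_form_eq0; apply/le_anti.
by rewrite le0 adjmx_form_ge0.
Qed.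

End Plucker.

Lemma eq_plucker (R : realType) n la (u u' : 'I_n -> R[i]) :
  u =1 u' -> plucker la u = plucker la u'.
Proof.
move=> e; apply/ffunP=> s; rewrite !ffunE; apply: eq_bigr => X _.
by congr (_ * _); apply: eq_bigr => i _; rewrite e.
Qed.

Theorem theorem1p1 (R : realType) :
  (forall (n k : nat) (la : seq nat) (x : nat -> R) (a : R),
      (1 <= k)%N -> (k <= n)%N -> part_of k la ->
      (forall i j : nat, (1 <= i)%N -> (i <= j)%N -> (j <= n.-1)%N ->
         x j <= x i) ->
      (forall i : nat, (1 <= i)%N -> (i <= n.-1)%N -> 0 < x i) ->
      0 < a ->
      vartheta R la / (1 - vartheta R la) * (\sum_(1 <= i < (n - k).+1) x i)
        <= a ->
      galg_selfadjoint (plucker la (@weights R n x a)) /\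
      galg_psd (plucker la (@weights R n x a)))
  /\
  (forall (k : nat) (la : seq nat) (c : R),
      (1 <= k)%N -> part_of k la ->
      c < vartheta R la / (1 - vartheta R la) ->
      exists x a : R,
        [/\ 0 < x, 0 < a, c * x <= a,
            galg_selfadjoint (plucker la (@weights R k.+1 (fun=> x) a)) &
            ~ galg_psd (plucker la (@weights R k.+1 (fun=> x) a))]).
Proof.
split=> [n k la x a k1 kn laP mono x0 a0 le_a|k la c k1 laP cltK]; last first.
  have /andP[pla /eqP sla] := laP.
  have la0 : la != [::] by apply: contraTneq k1 => la0; rewrite -sla la0.
  have K0 : 0 < vartheta R la / (1 - vartheta R la).
    by rewrite divr_gt0 ?vartheta_gt0 // subr_gt0 vartheta_lt1.
  (* With [x = 1], any positive [a] between [c] and [K] will do; [K / 2] keeps [a] positive when [c]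
     is not. *)
  set K := _ / _ in cltK K0; pose a := Num.max c (K / 2).
  have a0 : 0 < a by rewrite lt_max divr_gt0 ?orbT.
  have aK : a < K by rewrite gt_max cltK /=; lra.
  exists 1, a; split=> //; first by rewrite mulr1 le_max lexx.
    exact: plucker_selfadjoint.
  rewrite (@eq_plucker _ _ _ _ (fun i : 'I_k.+1 => (if i == ord_max then - a^-1 else 1)%:C%C)).
    exact: plucker_not_psd.
  by move=> i; rewrite /weights eqSS -val_eqE /= invr1.
split; first exact: plucker_selfadjoint.
case: n kn mono x0 le_a => [|n] kn mono x0 le_a; first by rewrite leqNgt k1 in kn.
have /andP[pla /eqP sla] := laP.
have la0 : la != [::] by apply: contraTneq k1 => la0; rewrite -sla la0.
apply: (@plucker_psd _ n k la (fun i => if i.+1 == n.+1 then - a^-1 else (x i.+1)^-1) a) => //.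
- by rewrite eqxx.
- move=> i; rewrite -val_eqE /= eqSS => ilt; rewrite (negPf ilt) invr_gt0 x0 //=.
  by rewrite ltn_neqAle ilt -ltnS ltn_ord.
move=> Y zY cY; apply: le_trans le_a; apply: ler_wpM2l.
  by rewrite divr_ge0 ?subr_ge0 ?ltW ?vartheta_gt0 ?vartheta_lt1.
apply: le_trans (sum_weights_le (mono : forall i j, _) zY cY).
apply: ler_sum => j; rewrite inE => jY; case: eqP => [[e]|_]; last by rewrite invrK.
by case/negP: jY; rewrite (_ : j = ord_max) //; apply: val_inj.
Qed.
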